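(* Let $\{\mathcal{M}_n\}$ be an irregular D-GLDPC ensemble sequence with check node types $I_c$ and variable node types $I_v$, with growth rate of the weight distribution $$G(\alpha) = \lim_{n\to\infty}\frac1n\log \mathbb{E}_{\mathcal{M}_n}[N_{\alpha n}],$$ the limit being taken over those positive integers $n$ for which $\alpha n\in\mathbb{Z}$ and $\mathbb{E}_{\mathcal{M}_n}[N_{\alpha n}]>0$ (where $\alpha>0$ is such that there are infinitely many such $n$). Then $$G(\alpha) = \sum_{t \in I_v} \delta_t \log B^{(t)}(x_{0},y_{0}) - \alpha \log x_{0} + \left( \frac{\int \rho}{\int \lambda} \right) \sum_{s \in I_c} \gamma_s \log A^{(s)}(z_0) + \frac{\log \left( 1 - \beta \int \lambda \right)}{\int \lambda},$$ where $x_0$, $y_0$, $z_0$ and $\beta$ are the unique positive real solutions to the $4\times 4$ system of equations (each of which becomes polynomial after multiplying across by an appropriate factor) $$z_0 \left( \frac{\int \rho}{\int \lambda} \right) \sum_{t \in I_c} \gamma_t \frac{ \frac{\mathrm{d} A^{(t)}}{\mathrm{d} z} (z_{0})}{A^{(t)}(z_{0})} = \beta,$$ $$x_0 \sum_{t \in I_v} \delta_t \frac{ \frac{\partial B^{(t)}}{\partial x} (x_{0},y_{0})}{B^{(t)}(x_{0},y_{0})} = \alpha,$$ $$y_0 \sum_{t \in I_v} \delta_t \frac{ \frac{\partial B^{(t)}}{\partial y} (x_{0},y_{0})}{B^{(t)}(x_{0},y_{0})} = \beta,$$ $$\left( \beta \int \lambda \right) (1 + y_0 z_0) = y_0 z_0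 .$$
   Context: All codes are binary and linear; $\log$ is the natural logarithm. **Node types.** There are finitely many check node (CN) types $t\in I_c=\{1,\dots,n_c\}$ and finitely many variable node (VN) types $t\in I_v=\{1,\dots,n_v\}$. A CN of type $t\in I_c$ is a linear block code of dimension $h_t$, length $s_t$ and minimum distance $r_t$. A VN of type $t\in I_v$ is a linear block code of dimension $k_t$, length $q_t$ and minimum distance $p_t$, together with a fixed $k_t\times q_t$ generator matrix (of rank $k_t$), which maps each local input word of $k_t$ bits to a local codeword of $q_t$ bits. **Weight enumerators.** For $t\in I_c$ the weight enumerating function is $A^{(t)}(z)=1+\sum_{u=r_t}^{s_t}A^{(t)}_u z^u$, where $A^{(t)}_u\ge 0$ is the number of weight-$u$ codewords of the type-$t$ CN code. For $t\in I_v$ the input-output weight enumerating function is $B^{(t)}(x,y)=1+\sum_{u=1}^{k_t}\sum_{v=p_t}^{q_t}B^{(t)}_{u,v}x^u y^v$, where $B^{(t)}_{u,v}\ge 0$ is the number of weight-$v$ local codewords generated by input words of weight $u$ for the type-$t$ VN. **Degree distributions.** $\rho_t$ ($t\in I_c$) is the fraction of edges of the Tanner graph connected to CNs of type $t$, and $\lambda_t$ ($t\in I_v$) is the fraction of edges connected to VNs of type $t$; so $\sum_{t\in I_c}\rho_t=\sum_{t\in I_v}\lambda_t=1$. All the quantities above are independent of $n$. Put $\rho(x)=\sum_{t\in I_c}\rho_t x^{s_t-1}$, $\lambda(x)=\sum_{t\in I_v}\lambda_t x^{q_t-1}$, $\int\rho=\int_0^1\rho(x)\,dx=\sum_{t\in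 I_c}\rho_t/s_t$, $\int\lambda=\int_0^1\lambda(x)\,dx=\sum_{t\in I_v}\lambda_t/q_t$. The fraction of CNs of type $t\in I_c$ and the fraction of VNs of type $t\in I_v$ are $$\gamma_t=\frac{\rho_t}{s_t\int\rho},\qquad \delta_t=\frac{\lambda_t}{q_t\int\lambda}.$$ **Ensemble $\mathcal{M}_n$.** Here $n$ is the number of VNs; the Tanner graph has $E=n/\int\lambda$ edges and $m=E\int\rho$ CNs. There are $E\lambda_t/q_t=\delta_t n$ VNs of type $t\in I_v$, each with $q_t$ edge sockets (one per local codeword position), and $E\rho_t/s_t=\gamma_t m$ CNs of type $t\in I_c$, each with $s_t$ edge sockets (only those $n$ for which these numbers are integers are considered). A member of $\mathcal{M}_n$ corresponds to a permutation of the $E$ edges, i.e. a bijection from the $E$ VN sockets to the $E$ CN sockets; $\mathbb{E}_{\mathcal{M}_n}$ is expectation over a uniformly random such permutation. **Codewords.** The code bits of the D-GLDPC code are the input bits of all the VNs, so its length is $N=\sum_{t\in I_v}(E\lambda_t/q_t)k_t$. A binary word of length $N$ is a codeword if, when each VN encodes its local input word with its generator matrix and places the resulting local codeword bits on its edges, the bits received through the permutation on the sockets of each CN form a codeword of that CN's local code. The weight of a codeword is its Hamming weight as a length-$N$ word (the total number of ones among the VN input bits), and $N_w$ denotes the number of codewords of weight $w$ of the code corresponding to the randomly chosen member of $\mathcal{M}_n$.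
   Formalization: Existence and uniqueness of the positive solution are assumed (they can fail for some α); and when the word putting a one on every edge is always a codeword of weight αn, the right-hand side is assumed to be nonnegative, since the formula can otherwise fail. *)

(* Defs.v *)
From HB Require Import structures.
From mathcomp Require Import all_boot all_order all_algebra.
From mathcomp Require Import all_classical all_reals all_analysis.

Set Implicit Arguments.
Unset Strict Implicit.
Unset Printing Implicit Defensive.

Import Order.TTheory GRing.Theory Num.Theory.
Import numFieldNormedType.Exports.
Local Open Scope classical_set_scope.
Local Open Scope ring_scope.

Definition hweight (n : nat) (c : 'rV['F_2]_n) : nat := #|[set j | c 0 j != 0]%SET|.

(* Meaningful only if [C] has a nonzero word, which the positive dimensions
   required below guarantee. *)
Definition min_distance (n : nat) (C : {pred 'rV['F_2]_n}) : nat :=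
  \big[minn/n]_(c | (c \in C) && (c != 0)) hweight c.

Record check_type := CheckType {
  clen : nat;
  ccode : {vspace 'rV['F_2]_clen};
  cdim_gt0 : (0 < \dim ccode)%N }.

Record var_type := VarType {
  vdim : nat;
  vlen : nat;
  vgen : 'M['F_2]_(vdim, vlen);
  vdim_gt0 : (0 < vdim)%N;
  vgen_free : row_free vgen }.

Definition cdist (T : check_type) : nat := min_distance [pred c | c \in ccode T].

Definition vdist (T : var_type) : nat := min_distance [pred c | (c <= vgen T)%MS].

Definition ccoef (T : check_type) (u : nat) : nat :=
  #|[set c | (c \in ccode T) && (hweight c == u)]%SET|.

(* [vgen T] is row free, so counting input words is counting codewords. *)
Definition vcoef (T : var_type) (u v : nat) : nat :=
  #|[set m | (hweight m == u) && (hweight (m *m vgen T) == v)]%SET|.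

Definition Aenum (R : realType) (T : check_type) (z : R) : R :=
  1 + \sum_(cdist T <= u < (clen T).+1) (ccoef T u)%:R * z ^+ u.

Definition Benum (R : realType) (T : var_type) (x y : R) : R :=
  1 + \sum_(1 <= u < (vdim T).+1) \sum_(vdist T <= v < (vlen T).+1)
        (vcoef T u v)%:R * x ^+ u * y ^+ v.

Definition Aenum_z (R : realType) (T : check_type) (z : R) : R :=
  derive1 (fun s => Aenum T s) z.

Definition Benum_x (R : realType) (T : var_type) (x y : R) : R :=
  derive1 (fun s => Benum T s y) x.

Definition Benum_y (R : realType) (T : var_type) (x y : R) : R :=
  derive1 (fun s => Benum T x s) y.

Record ensemble (R : realType) := Ensemble {
  nc : nat;
  nv : nat;
  ctype : 'I_nc -> check_type;
  vtype : 'I_nv -> var_type;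
  rho : 'I_nc -> R;
  lambda : 'I_nv -> R;
  rho_ge0 : forall t, 0 <= rho t;
  lambda_ge0 : forall t, 0 <= lambda t;
  sum_rho : \sum_t rho t = 1;
  sum_lambda : \sum_t lambda t = 1 }.

Arguments ctype {R} e t.
Arguments vtype {R} e t.
Arguments rho {R} e t.
Arguments lambda {R} e t.

Lemma clen_gt0 (T : check_type) : (0 < clen T)%N.
Proof.
have := leq_trans (cdim_gt0 T) (dimvS (subvf (ccode T))).
by rewrite dimvf dim_matrix; case: (clen T).
Qed.

Lemma vlen_gt0 (T : var_type) : (0 < vlen T)%N.
Proof.
apply: leq_trans (vdim_gt0 T) _.
by rewrite -(eqP (vgen_free T)) rank_leq_col.
Qed.

Lemma Rintegral_edge_poly (R : realType) (k : nat) (c : 'I_k -> R)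
    (d : 'I_k -> nat) : (forall t, (0 < d t)%N) ->
  \int[@lebesgue_measure R]_(x in `[0, 1]) (\sum_t c t * x ^+ (d t).-1) =
  \sum_t c t / (d t)%:R.
Proof.
move=> d_gt0.
pose P : {poly R} := \sum_t (c t / (d t)%:R) *: 'X^(d t).
have hP x : P.[x] = \sum_t c t / (d t)%:R * x ^+ d t.
  by rewrite horner_sum; apply: eq_bigr => t _; rewrite !hornerE.
have hP' x : (P^`()).[x] = \sum_t c t * x ^+ (d t).-1.
  rewrite raddf_sum horner_sum; apply: eq_bigr => t _ /=.
  rewrite derivZ derivXn !hornerE hornerMn hornerXn.
  by rewrite mulrnAr -mulrnAl -[(_ / _) *+ _]mulr_natr divfK// pnatr_eq0 -lt0n.
rewrite /Rintegral (@continuous_FTC2 _ _ (horner P))//=.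
- rewrite !hP [X in _ - X]big1 ?subr0 => [|t _].
    by apply: eq_bigr => t _; rewrite expr1n mulr1.
  by rewrite expr0n gtn_eqF// mulr0.
- apply: continuous_subspaceT => x.
  rewrite (_ : (fun x => _) = horner (P^`())); first exact: continuous_horner.
  by apply/funext => y; rewrite hP'.
- split.
  + by move=> x _; exact: derivable_horner.
  + by apply: cvg_at_right_filter; exact: continuous_horner.
  + by apply: cvg_at_left_filter; exact: continuous_horner.
- by move=> x _; rewrite -derivE hP'.
Qed.

Section Ensemble.
Variables (R : realType) (M : ensemble R).

Definition int_rho : R :=
  \int[@lebesgue_measure R]_(x in `[0, 1])
    (\sum_t rho M t * x ^+ (clen (ctype M t)).-1).
Definition int_lambda : R :=
  \int[@lebesgue_measure R]_(x in `[0, 1])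
    (\sum_t lambda M t * x ^+ (vlen (vtype M t)).-1).

Lemma int_rhoE : int_rho = \sum_t rho M t / (clen (ctype M t))%:R.
Proof. by apply: Rintegral_edge_poly => t; exact: clen_gt0. Qed.

Lemma int_lambdaE : int_lambda = \sum_t lambda M t / (vlen (vtype M t))%:R.
Proof. by apply: Rintegral_edge_poly => t; exact: vlen_gt0. Qed.

Definition gamma (t : 'I_(nc M)) : R :=
  rho M t / ((clen (ctype M t))%:R * int_rho).
Definition delta (t : 'I_(nv M)) : R :=
  lambda M t / ((vlen (vtype M t))%:R * int_lambda).

(* Numbers of edges and of nodes of each type, as functions of the number [n]
   of VNs; the truncations are exact when [admissible n] holds. *)
Definition edges (n : nat) : R := n%:R / int_lambda.
Definition nchecks (n : nat) (t : 'I_(nc M)) : nat :=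
  Num.truncn (edges n * rho M t / (clen (ctype M t))%:R).
Definition nvars (n : nat) (t : 'I_(nv M)) : nat :=
  Num.truncn (edges n * lambda M t / (vlen (vtype M t))%:R).
Definition admissible (n : nat) : Prop :=
  (forall t, edges n * rho M t / (clen (ctype M t))%:R \is a Num.nat) /\
  (forall t, edges n * lambda M t / (vlen (vtype M t))%:R \is a Num.nat).

Section Codes.
Variable n : nat.

Definition cnode : finType := {t : 'I_(nc M) & 'I_(nchecks n t)}.
Definition vnode : finType := {t : 'I_(nv M) & 'I_(nvars n t)}.
Definition csocket : finType := {c : cnode & 'I_(clen (ctype M (tag c)))}.
Definition vsocket : finType := {v : vnode & 'I_(vlen (vtype M (tag v)))}.
Definition inbit : finType := {v : vnode & 'I_(vdim (vtype M (tag v)))}.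

Definition word : finType := {ffun inbit -> 'F_2}.

Definition local_input (w : word) (v : vnode) :
    'rV['F_2]_(vdim (vtype M (tag v))) :=
  \row_j w (Tagged (fun v : vnode => 'I_(vdim (vtype M (tag v)))) j).

Definition local_codeword (w : word) (v : vnode) :
    'rV['F_2]_(vlen (vtype M (tag v))) :=
  local_input w v *m vgen (vtype M (tag v)).

Definition sent (w : word) (s : vsocket) : 'F_2 :=
  local_codeword w (tag s) 0 (tagged s).

Definition interleaver : {set {ffun vsocket -> csocket}} :=
  [set f : {ffun vsocket -> csocket} |
    injectiveb f && [forall s, exists r, f r == s]]%SET.

Definition received (f : {ffun vsocket -> csocket}) (w : word) (s : csocket) :
    'F_2 :=
  if [pick r | f r == s] is Some r then sent w r else 0.

Definition is_codeword (f : {ffun vsocket -> csocket}) (w : word) : bool :=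
  [forall c : cnode,
    (\row_j received f w
       (Tagged (fun c : cnode => 'I_(clen (ctype M (tag c)))) j))
    \in ccode (ctype M (tag c))].

Definition word_weight (w : word) : nat := #|[set i | w i != 0]%SET|.

Definition num_codewords (f : {ffun vsocket -> csocket}) (k : nat) : nat :=
  #|[set w : word | is_codeword f w && (word_weight w == k)]%SET|.

Definition expected_num (k : nat) : R :=
  (\sum_(f in interleaver) (num_codewords f k)%:R) / #|interleaver|%:R.

End Codes.

Definition growth_index (alpha : R) : set nat :=
  [set n | [/\ (0 < n)%N, admissible n, alpha * n%:R \is a Num.int &
     0 < expected_num n (Num.truncn (alpha * n%:R))]].

Definition growth_seq (alpha : R) (n : nat) : R :=
  ln (expected_num n (Num.truncn (alpha * n%:R))) / n%:R.

Definition is_positive_solution (alpha x y z beta : R) : Prop :=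
  [/\ 0 < x, 0 < y, 0 < z & 0 < beta] /\
  [/\ z * (int_rho / int_lambda) *
        (\sum_t gamma t * (Aenum_z (ctype M t) z / Aenum (ctype M t) z)) = beta,
      x * (\sum_t delta t *
             (Benum_x (vtype M t) x y / Benum (vtype M t) x y)) = alpha,
      y * (\sum_t delta t *
             (Benum_y (vtype M t) x y / Benum (vtype M t) x y)) = beta &
      beta * int_lambda * (1 + y * z) = y * z].

Definition growth_formula (alpha x y z beta : R) : R :=
  \sum_t delta t * ln (Benum (vtype M t) x y) - alpha * ln x
  + int_rho / int_lambda * (\sum_t gamma t * ln (Aenum (ctype M t) z))
  + ln (1 - beta * int_lambda) / int_lambda.

(* Sending the bit 1 on every edge gives a codeword, whatever the permutation,
   and the weight of this codeword is [alpha * n].  It makes the expected number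
   of codewords at least 1, and it lies at the endpoint
   [beta * int_lambda = 1], which no positive solution of the system reaches. *)
Definition all_one_codeword (alpha : R) : Prop :=
  (forall t, 0 < rho M t -> const_mx 1 \in ccode (ctype M t)) /\
  exists2 m : forall t, 'rV['F_2]_(vdim (vtype M t)),
    (forall t, 0 < lambda M t -> m t *m vgen (vtype M t) = const_mx 1) &
    \sum_t delta t * (hweight (m t))%:R = alpha.

End Ensemble.

(* Main.v *)
(** Group the codewords by their joint type: the number of variable nodes with
    each local input word and of check nodes with each local codeword.  The
    number of configurations of a given type is a product of multinomial
    coefficients, and a configuration with [j] ones on the [E] edges is realized
    by a random permutation with probability [1 / 'C(E, j)].  By Stirling's
    bounds the contribution of a type is [exp (n * Phi + O(ln n))], where [Phi]
    is a sum of entropies minus [L * H(b / L)], with [b = j / n] and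
    [L = E / n]; since there are only polynomially many types, the growth rate
    is the maximum of [Phi] over the polytope of types.

    [Phi] is not concave, but it has a maximizer.  If [b < L] there, then all
    coordinates are positive, because entropy has infinite slope at zero, and
    Lagrange multipliers make the maximizer the exponential family point of a
    positive solution of the system; uniqueness of the solution identifies it.
    If [b = L] then all edges carry a one and [Phi = 0], which the hypothesis on
    the all-one codeword bounds by the formula.  The lower bound needs a
    type with exactly the right integral weights near the maximizer: the kernel
    of the integral constraints has an integral basis, so some feasible
    integral type lies within bounded distance of [n] times the maximizer. *)

Require Import Defs.
From mathcomp Require Import all_boot all_order all_algebra all_fingroup.
From mathcomp Require Import all_classical all_reals all_analysis.
From mathcomp Require Import ring lra.
Import Order.TTheory GRing.Theory Num.Theory.
Import numFieldNormedType.Exports.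

Set Implicit Arguments.
Unset Strict Implicit.
Unset Printing Implicit Defensive.

(** * Bijections preserving a labelling *)

Section LabelledBijections.

Definition fiber (A B : finType) (f : A -> B) (b : B) : {set A} := [set a | f a == b].

Lemma card_fiber_sum (A B : finType) (f : A -> B) : #|A| = \sum_b #|fiber f b|.
Proof.
rewrite -sum1_card (partition_big f xpredT)//=; apply: eq_bigr => b _.
by rewrite sum1dep_card.
Qed.

(** Within each fiber an element goes to the element of the same rank in the enumeration of the
    other fiber; different fibers stay apart because the label is preserved. *)
Lemma labelled_bij_exists (A A' B : finType) (f : A -> B) (g : A' -> B) :
  (forall b, #|fiber f b| = #|fiber g b|) ->
  exists2 h : A -> A', injective h & forall a, g (h a) = f a.
Proof.
(* [nth] needs a default element; if [A'] is empty, then all fibers are empty and so is [A]. *)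
move=> fg; have [a' _|A'0] := pickP (fun _ : A' => true); last first.
  have A0 : #|A| = 0.
    rewrite (card_fiber_sum f) big1// => b _; rewrite fg.
    by apply: eq_card0 => a'; have := A'0 a'.
  have noA (a : A) : False by have := fintype0 a A0.
  by exists (fun a => False_rect A' (noA a)) => a; case: (noA a).
pose h a := nth a' (enum (fiber g (f a))) (index a (enum (fiber f (f a)))).
have hlt a : index a (enum (fiber f (f a))) < size (enum (fiber g (f a))).
  by rewrite -cardE -fg cardE index_mem mem_enum inE.
have gh a : g (h a) = f a.
  by have := mem_nth a' (hlt a); rewrite mem_enum inE => /eqP.
exists h => // a1 a2 e; have e' : f a1 = f a2 by rewrite -!gh e.
have h1 : index a1 (enum (fiber f (f a2))) < size (enum (fiber g (f a2))).
  by rewrite -e'; exact: hlt.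
have /eqP := e; rewrite /h e'.
rewrite (nth_uniq _ h1 (hlt a2) (enum_uniq _)) => /eqP /(index_inj a1); apply.
  by rewrite mem_enum inE e'.
by rewrite mem_enum inE.
Qed.

(** A label-preserving permutation is an independent choice of a permutation supported on each
    fiber: [join] glues such a family together and [restr_perm] takes it apart. *)
Lemma card_perm_preserving (A B : finType) (f : A -> B) :
  #|[set s : {perm A} | [forall a, f (s a) == f a]]| = \prod_b (#|fiber f b|)`!.
Proof.
pose F b : {pred {perm A}} := perm_on (fiber f b).
have -> : \prod_b (#|fiber f b|)`! = #|family F|.
  rewrite card_family foldrE big_image /=.
  by apply: eq_bigr => b _; rewrite card_perm.
pose join (t : {ffun B -> {perm A}}) : {perm A} := 
  odflt (perm_one A) [pick s : {perm A} | [forall a, s a == t (f a) a]].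
have pres t b a : t \in family F -> (f (t b a) == b) = (f a == b).
  by move=> /familyP/(_ b) tF; have := perm_closed a tF; rewrite !inE.
have joinE t a : t \in family F -> join t a = t (f a) a.
  move=> tF; have tI : injective (fun a => t (f a) a).
    move=> a1 a2 /= e; have e' : f a1 = f a2.
      have /eqP <- : f (t (f a1) a1) == f a1 by rewrite pres.
      by rewrite e; apply/eqP; rewrite pres.
    by move: e; rewrite e'; exact: perm_inj.
  rewrite /join; case: pickP => [s /forallP sE|/(_ (perm tI))/forallP[]]; first exact/eqP.
  by move=> a'; rewrite permE.
rewrite -(card_in_imset (f := join) (D := family F)); last first.
  move=> t t' tF t'F e; apply/ffunP => b; apply/permP => a.
  have [ab|ab] := eqVneq (f a) b.
    by rewrite -ab -!joinE// e.
  have nb : a \notin fiber f b by rewrite inE.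
  by rewrite !(out_perm _ nb)//; [move/familyP: t'F => /(_ b)|move/familyP: tF => /(_ b)].
apply: eq_card => s; rewrite inE; apply/forallP/imsetP => [sf|[t tF ->] a]; last first.
  by rewrite joinE// pres.
pose t := [ffun b => restr_perm (fiber f b) s].
have tF : t \in family F by apply/familyP => b; rewrite ffunE; exact: restr_perm_on.
exists t => //; apply/permP => a; rewrite joinE// ffunE.
have sN : s \in 'N(fiber f (f a) | 'P)%g.
  by apply/astabsP => a'; rewrite !inE /= apermE (eqP (sf a')).
by rewrite restr_permE// inE.
Qed.

(** Composition with one fixed label-preserving bijection [h0] reduces the count to permutations of
    [A]. *)
Lemma card_labelled_bij (A A' B : finType) (f : A -> B) (g : A' -> B) :
  (forall b, #|fiber f b| = #|fiber g b|) ->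
  #|[set h : {ffun A -> A'} | injectiveb h && [forall a, g (h a) == f a]]|
    = \prod_b (#|fiber f b|)`!.
Proof.
move=> fg; rewrite -card_perm_preserving.
have [h0 h0I h0g] := labelled_bij_exists fg.
have cA : #|A| = #|A'|.
  by rewrite (card_fiber_sum f) (card_fiber_sum g); apply: eq_bigr => b _.
have [k0 h0K k0K] : bijective h0 by apply: inj_card_bij => //; rewrite cA.
pose G (s : {perm A}) := [ffun a => h0 (s a)].
rewrite -(card_imset (f := G)); last first.
  by move=> s t /ffunP e; apply/permP => a; have := e a; rewrite !ffunE => /h0I.
apply: eq_card => h; rewrite inE; apply/andP/imsetP => [[/injectiveP hI /forallP hg]|[s]].
  have kI : injective (k0 \o h) by apply: inj_comp => //; exact: can_inj k0K.
  exists (perm kI); last by apply/ffunP => a; rewrite ffunE permE /= k0K.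
  by rewrite inE; apply/forallP => a; rewrite permE /= -h0g k0K.
rewrite inE => /forallP sf ->; split.
  by apply/injectiveP => a b; rewrite !ffunE => /h0I /perm_inj.
by apply/forallP => a; rewrite ffunE h0g.
Qed.

(** A multinomial count without division. For a fixed member [F0] of the class, [s |-> F0 \o s] maps
    the [phi]-preserving permutations onto the class, and every member has as many preimages as the
    product of the factorials of the [N i]. *)
Lemma card_type_class (A I T : finType) (phi : A -> T) (psi : I -> T) (N : I -> nat) :
  (forall t, \sum_(i | psi i == t) N i = #|fiber phi t|) ->
  #|[set F : {ffun A -> I} | [forall a, psi (F a) == phi a] &&
      [forall i, #|fiber F i| == N i]]| * \prod_i (N i)`! =
  \prod_t (#|fiber phi t|)`!.
Proof.
move=> hN; pose A' : finType := {i : I & 'I_(N i)}.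
have cardA' (P : pred I) : #|[set x : A' | P (tag x)]| = \sum_(i | P i) N i.
  rewrite -sum1dep_card.
  rewrite (eq_bigr (fun i => \sum_(j < N i) 1)); last by move=> i _; rewrite sum1_card card_ord.
  rewrite (@sig_big_dep _ _ _ _ (fun i => 'I_(N i)) P (fun=> xpredT) (fun _ _ => 1)) /=.
  by apply: eq_bigl => x; rewrite andbT.
have [b|h0 h0I h0g] := @labelled_bij_exists A A' T phi (psi \o tag).
  by rewrite -hN -cardA'.
have cA : #|A'| <= #|A|.
  rewrite (card_fiber_sum phi) (card_fiber_sum (psi \o @tag _ _ : A' -> T)).
  by apply: leq_sum => t _; rewrite -hN -cardA'.
have [k0 h0K k0K] : bijective h0 by exact: inj_card_bij.
pose F0 a := tag (h0 a).
have F0N i : #|fiber F0 i| = N i.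
  have -> : N i = #|[set x : A' | pred1 i (tag x)]| by rewrite cardA' big_pred1_eq.
  rewrite -(card_imset _ h0I); apply: eq_card => x; rewrite inE.
  apply/imsetP/idP => [[a]|xi]; first by rewrite inE => /eqP <- ->; rewrite /= eqxx.
  by exists (k0 x); rewrite ?k0K// inE /F0 k0K.
pose cls := [set F : {ffun A -> I} | [forall a, psi (F a) == phi a] &&
      [forall i, #|fiber F i| == N i]].
rewrite -(@card_labelled_bij A A T phi phi)// -[RHS]sum1dep_card.
rewrite [RHS](partition_big (fun s : {ffun A -> A} => [ffun a => F0 (s a)]) (mem cls)).
  rewrite -sum_nat_const; apply: eq_bigr => F; rewrite !inE => /andP[/forallP Fp /forallP FN].
  rewrite sum1dep_card (eq_bigr (fun i => (#|fiber F i|)`!)); last by move=> i _; rewrite (eqP (FN i)).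
  rewrite -(@card_labelled_bij A A I F F0); last by move=> i; rewrite F0N (eqP (FN i)).
  apply: eq_card => s; rewrite !inE -andbA; congr andb.
  apply/forallP/andP => [h|[_ /eqP/ffunP h] a]; last by have := h a; rewrite ffunE => ->.
  split; last by apply/eqP/ffunP => a; rewrite ffunE (eqP (h a)).
  by apply/forallP => a; rewrite -h0g /= -(eqP (Fp a)) -(eqP (h a)).
move=> s /andP[/injectiveP sI /forallP sp]; rewrite !inE; apply/andP; split.
  by apply/forallP => a; rewrite ffunE -(eqP (sp a)) -h0g.
apply/forallP => i; rewrite -F0N -(card_imset _ sI).
have [r sK rK] : bijective s by exact: injF_bij.
apply/eqP/eq_card => a; rewrite inE; apply/imsetP/idP => [[b]|/eqP ai].
  by rewrite inE ffunE => /eqP <- ->.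
by exists (r a); rewrite ?rK// inE ffunE rK ai.
Qed.

End LabelledBijections.

Local Open Scope classical_set_scope.
Local Open Scope ring_scope.

(** * The function x ln x and Stirling bounds *)

(* [ln] is [0] on nonpositive numbers, so [eta] is continuous on the whole line. *)
Definition eta (R : realType) (x : R) : R := - (x * ln x).

Section Eta.
Context {R : realType}.
Implicit Types x y : R.

Lemma eta0 : eta 0 = 0 :> R. Proof. by rewrite /eta mul0r oppr0. Qed.

Lemma ln_le_sub1 x : 0 < x -> ln x <= x - 1.
Proof. by move=> x0; have := @le_ln1Dx R (x - 1); rewrite addrCA subrr addr0; apply; lra. Qed.

Lemma etaM x y : 0 < x -> 0 <= y -> eta (x * y) = x * eta y - x * y * ln x.
Proof.
move=> x0; rewrite le_eqVlt => /predU1P[<-|y0]; first by rewrite mulr0 eta0; ring.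
by rewrite /eta lnM ?posrE//; ring.
Qed.

(** Concavity, from [ln u <= u - 1] at [u = x / y]; the endpoint [y = 0] is checked apart. *)
Lemma eta_le_tangent x y : 0 < x -> 0 <= y ->
  eta y <= eta x - (y - x) * (ln x + 1).
Proof.
move=> x0; rewrite le_eqVlt => /predU1P[<-|y0]; first by rewrite /eta; lra.
have h : ln (x / y) <= x / y - 1 by apply: ln_le_sub1; rewrite divr_gt0.
have : y * ln (x / y) <= y * (x / y - 1) by rewrite ler_wpM2l// ltW.
have -> : y * (x / y - 1) = x - y by field; rewrite gt_eqF.
rewrite ln_div ?posrE// /eta; lra.
Qed.

(** A second order lower bound that holds up to the endpoint [x + h = 0], although the second
    derivative blows up there; again [ln u <= u - 1], now at [u = (x + h) / x]. *)
Lemma eta_ge_tangent x h : 0 < x -> 0 <= x + h ->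
  eta x - h * (ln x + 1) - h ^+ 2 / x <= eta (x + h).
Proof.
move=> x0; rewrite le_eqVlt => /predU1P[e|y0].
  have -> : h = - x by rewrite -[RHS]addr0 e addKr.
  rewrite subrr eta0 /eta sqrrN expr2 mulfK ?gt_eqF//; lra.
have h1 : ln ((x + h) / x) <= (x + h) / x - 1 by apply: ln_le_sub1; rewrite divr_gt0.
have : (x + h) * ln ((x + h) / x) <= (x + h) * ((x + h) / x - 1).
  by rewrite ler_wpM2l// ltW.
rewrite ln_div ?posrE// /eta [X in _ <= X](_ : _ = h + h ^+ 2 / x); first lra.
by field; rewrite gt_eqF.
Qed.

Lemma eta_concave x y e : 0 <= x -> 0 <= y -> 0 <= e <= 1 ->
  eta x + e * (eta y - eta x) <= eta (x + e * (y - x)).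
Proof.
move=> x0 y0 /andP[e0 e1].
have : 0 <= x + e * (y - x).
  have -> : x + e * (y - x) = (1 - e) * x + e * y by ring.
  by rewrite addr_ge0 ?mulr_ge0// subr_ge0.
(* Both ends are compared with the tangent at the intermediate point, which needs that point to be
   positive; if it is 0, every end of nonzero weight is 0. *)
rewrite le_eqVlt => /predU1P[h|z0]; last first.
  have hx := eta_le_tangent z0 x0; have hy := eta_le_tangent z0 y0.
  set z := x + e * (y - x) in z0 hx hy *.
  have hx' : (1 - e) * eta x <= (1 - e) * (eta z - (x - z) * (ln z + 1)).
    by rewrite ler_wpM2l// subr_ge0.
  have hy' : e * eta y <= e * (eta z - (y - z) * (ln z + 1)) by rewrite ler_wpM2l.
  have : (1 - e) * (eta z - (x - z) * (ln z + 1)) + e * (eta z - (y - z) * (ln z + 1))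
     = eta z by rewrite /z; ring.
  lra.
have hxy : (1 - e) * x = 0 /\ e * y = 0.
  have : (1 - e) * x + e * y == 0 by apply/eqP; rewrite h; ring.
  rewrite paddr_eq0; [|by rewrite mulr_ge0// subr_ge0|by rewrite mulr_ge0//].
  by case/andP => /eqP ? /eqP ?.
rewrite -h eta0.
case: hxy => /eqP; rewrite mulf_eq0 => /orP[/eqP E /eqP|/eqP -> /eqP].
  rewrite mulf_eq0 => /orP[/eqP E'|/eqP ->]; first lra.
  by rewrite eta0 (_ : e = 1); lra.
by rewrite mulf_eq0 eta0 => /orP[/eqP ->|/eqP ->]; rewrite ?eta0; lra.
Qed.

Lemma ln_le_2sqrt x : 0 < x -> ln x <= 2 * Num.sqrt x.
Proof.
move=> x0; have sx : 0 < Num.sqrt x by rewrite sqrtr_gt0.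
rewrite -{1}(sqr_sqrtr (ltW x0)) lnXn// -[ln _ *+ _]mulr_natl ler_wpM2l//.
exact: ltW (ln_sublinear sx).
Qed.

(** Controls [eta] near 0, by [ln u <= 2 * Num.sqrt u] at [u = x^-1]. *)
Lemma eta_norm_le x : 0 <= x <= 1 -> `|eta x| <= 2 * Num.sqrt x.
Proof.
move=> /andP[]; rewrite le_eqVlt => /predU1P[<-|x0 x1].
  by rewrite eta0 normr0 mulr_ge0 ?sqrtr_ge0.
have sx : 0 < Num.sqrt x by rewrite sqrtr_gt0.
rewrite /eta -mulrN normrM gtr0_norm// ger0_norm ?oppr_ge0 ?ln_le0// -lnV ?posrE//.
have h : ln x^-1 <= 2 * Num.sqrt x^-1 by apply: ln_le_2sqrt; rewrite invr_gt0.
apply: (@le_trans _ _ (x * (2 * Num.sqrt x^-1))); first by apply: ler_wpM2l => //; exact: ltW.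
rewrite (sqrtrV (ltW x0)) -{1}(sqr_sqrtr (ltW x0)) le_eqVlt; apply/orP; left.
by apply/eqP; field; rewrite gt_eqF.
Qed.

Lemma eta_le0 x : x <= 0 -> eta x = 0.
Proof. by move=> x0; rewrite /eta ln0// mulr0 oppr0. Qed.

Lemma continuous_eta : continuous (@eta R).
Proof.
move=> x; have [x0|x0] := ltP 0 x.
  by apply: cvgN; apply: cvgM; [exact: cvg_id|exact: continuous_ln].
rewrite /continuous_at (eta_le0 x0); apply/cvgr0Pnorm_le => e e0.
have : 2 * Num.sqrt y @[y --> x] --> 2 * Num.sqrt x.
  by apply: cvgM; [exact: cvg_cst|exact: sqrt_continuous].
rewrite ler0_sqrtr// mulr0 => /cvgr0Pnorm_le /(_ _ e0) h.
near=> y; have [y0|y0] := leP y 0; first by rewrite eta_le0// normr0 ltW.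
apply: (@le_trans _ _ (2 * Num.sqrt y)).
  apply: eta_norm_le; rewrite (ltW y0)/=; apply/ltW; near: y.
  by apply: lt_nbhsl; apply: le_lt_trans x0 _.
by apply: le_trans (ler_norm _) _; near: y.
Unshelve. all: by end_near. Qed.

(** The increment of [k ln k], split so that the inductions for the Stirling bounds only have to
    estimate [ln (1 + 1 / k)]. *)
Lemma etaS k :
  eta k.+1%:R = eta k%:R - ln k.+1%:R - k%:R * ln (1 + k%:R^-1) :> R.
Proof.
case: k => [|k]; first by rewrite /eta ln1; ring.
have k0 : 0 < k.+1%:R :> R by rewrite ltr0n.
rewrite -[k.+2%:R]natr1; move: (k.+1%:R) k0 => x x0.
have -> : 1 + x^-1 = (x + 1) / x by field; rewrite gt_eqF.
by rewrite ln_div ?posrE ?addr_gt0// /eta; ring.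
Qed.

Lemma natr_fact_gt0 k : 0 < k`!%:R :> R.
Proof. by rewrite ltr0n fact_gt0. Qed.

Lemma ln_fact_ge k : - eta k%:R - k%:R <= ln k`!%:R :> R.
Proof.
elim: k => [|k IH]; first by rewrite eta0 fact0 ln1; lra.
rewrite factS natrM lnM ?posrE ?ltr0n ?fact_gt0// etaS.
suff : k%:R * ln (1 + k%:R^-1) <= 1 :> R by rewrite -!natr1; lra.
case: k {IH} => [|k]; first by rewrite mul0r.
have k0 : 0 < k.+1%:R :> R by rewrite ltr0n.
have : ln (1 + k.+1%:R^-1) <= k.+1%:R^-1 :> R.
  by apply: le_ln1Dx; apply: lt_le_trans (ltrN10 _) _; rewrite invr_ge0.
by rewrite -(ler_pM2l k0) divff ?gt_eqF.
Qed.

(** For positive [k] the induction proves the bound with [ln k], using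
    [1 <= (k + 1) ln (1 + 1 / k)]; weakening to [ln k.+1] covers [k = 0]. *)
Lemma ln_fact_le k : ln k`!%:R <= - eta k%:R - k%:R + 1 + ln k.+1%:R :> R.
Proof.
case: k => [|k]; first by rewrite eta0 fact0 ln1; lra.
apply: (@le_trans _ _ (- eta k.+1%:R - k.+1%:R + 1 + ln k.+1%:R)); last first.
  by rewrite lerD2l ler_ln ?posrE ?ltr0n// ler_nat.
elim: k => [|k IH]; first by rewrite /eta factS fact0 ln1; lra.
rewrite factS natrM lnM ?posrE ?ltr0n ?fact_gt0// etaS -[k.+2%:R]natr1.
have k0 : 0 < k.+1%:R :> R by rewrite ltr0n.
move: (ln k.+1`!%:R) (k.+1%:R) k0 IH => y x x0 IH.
have x10 : 0 < x + 1 by rewrite addr_gt0.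
have h : 1 <= (x + 1) * ln (1 + x^-1).
  have -> : 1 + x^-1 = (x + 1) / x by field; rewrite gt_eqF.
  have : (x + 1) * ln (x / (x + 1)) <= (x + 1) * (x / (x + 1) - 1).
    by rewrite ler_pM2l// ln_le_sub1// divr_gt0.
  have -> : (x + 1) * (x / (x + 1) - 1) = -1 by field; rewrite gt_eqF.
  by rewrite !ln_div ?posrE//; lra.
have e : ln (1 + x^-1) = ln (x + 1) - ln x.
  by rewrite -ln_div ?posrE//; congr ln; field; rewrite gt_eqF.
by move: h; rewrite mulrDl mul1r e; lra.
Qed.

(** The error of the approximation [k ln k - k] to the logarithm of the factorial. *)
Definition fact_err (k : nat) : R := ln k`!%:R + eta k%:R + k%:R.

Lemma fact_err_ge0 k : 0 <= fact_err k.
Proof. by have := ln_fact_ge k; rewrite /fact_err; lra. Qed.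

Lemma fact_err_le k x : k%:R <= x -> fact_err k <= 1 + ln (x + 1).
Proof.
move=> kx; have x1 : 0 < x + 1 by rewrite ltr_wpDl// (le_trans _ kx).
have : ln k.+1%:R <= ln (x + 1) by rewrite ler_ln ?posrE ?ltr0n// -natr1 lerD2r.
by have := ln_fact_le k; rewrite /fact_err; lra.
Qed.

End Eta.

(** * Integer points near real kernels *)

Section Enum.
Context {I : finType}.

Lemma sum_enum_val (V : nmodType) (f : I -> V) :
  \sum_(j < #|I|) f (enum_val j) = \sum_i f i.
Proof.
by rewrite -big_enum_val; apply: eq_bigl => i; rewrite inE.
Qed.

Lemma sum_enum_rank (V : nmodType) (f : 'I_#|I| -> V) :
  \sum_i f (enum_rank i) = \sum_(j < #|I|) f j.
Proof. by rewrite -sum_enum_val; apply: eq_bigr => j _; rewrite enum_valK. Qed.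

End Enum.

(** A row that annihilates the kernel of a matrix lies in its row space; this is tested on the
    columns of [cokermx]. The coefficients [mu] will be Lagrange multipliers. *)
Lemma lin_comb_of_kernel (F : fieldType) (I K : finType) (C : K -> I -> F)
    (g : I -> F) :
  (forall d, (forall k, \sum_i C k i * d i = 0) -> \sum_i g i * d i = 0) ->
  exists mu : K -> F, forall i, g i = \sum_k mu k * C k i.
Proof.
move=> h.
pose A := \matrix_(k < #|K|, i < #|I|) C (enum_val k) (enum_val i).
pose r : 'rV_#|I| := \row_i g (enum_val i).
have /submxP[m rE] : (r <= A)%MS.
  rewrite submxE; apply/eqP/rowP => j.
  have := h (fun i => cokermx A (enum_rank i) j).
  rewrite mxE -sum_enum_val => hh.
  rewrite [RHS]mxE; under eq_bigr => i do rewrite mxE.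
  rewrite -[RHS]hh; first by apply: eq_bigr => i _; rewrite enum_valK.
  move=> k; have /matrixP/(_ (enum_rank k) j) := mulmx_coker A.
  rewrite !mxE => e; rewrite -[RHS]e -[LHS]sum_enum_val.
  by apply: eq_bigr => i _; rewrite !mxE enum_valK enum_rankK.
exists (fun k => m 0 (enum_rank k)) => i.
have /rowP/(_ (enum_rank i)) := rE; rewrite !mxE enum_rankK => ->.
by rewrite -sum_enum_rank; apply: eq_bigr => k _; rewrite mxE !enum_rankK.
Qed.

(** The rows of the rational kernel matrix become integral after multiplication by a common
    denominator [D], and they span the real kernel because kernels commute with field extension.
    Only spanning is claimed, not independence. *)
Lemma int_kernel_basis (I K : finType) (C : K -> I -> int) (R : archiRealFieldType) :
  exists b : 'I_#|I| -> I -> int,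
    (forall l k, \sum_i C k i * b l i = 0) /\
    forall d : I -> R, (forall k, \sum_i (C k i)%:~R * d i = 0) ->
      exists e : 'I_#|I| -> R, forall i, d i = \sum_l e l * (b l i)%:~R.
Proof.
pose A : 'M[rat]_(#|I|, #|K|) := \matrix_(i, k) (C (enum_val k) (enum_val i))%:~R.
pose B := kermx A.
pose D : int := \prod_l \prod_i denq (B l i).
have D0 : D != 0 by apply/prodf_neq0 => l _; apply/prodf_neq0 => i _; rewrite denq_neq0.
have hint l i : D%:~R * B l i \is a Num.int.
  rewrite /D (bigD1 l)//= (bigD1 i)//= -mulrA mulrC rmorphM/= mulrA.
  by rewrite -numqE -rmorphM/= intr_int.
pose b l i := numq (D%:~R * B l (enum_rank i)).
have bE l i : (b l i)%:~R = D%:~R * B l (enum_rank i) by rewrite /b numqK.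
exists b; split=> [l k|d hd].
  apply: (@intr_inj rat); rewrite rmorph_sum /=.
  have AE i : A (enum_rank i) (enum_rank k) = (C k i)%:~R by rewrite mxE !enum_rankK.
  have /matrixP/(_ l (enum_rank k)) := mulmx_ker A; rewrite mxE [RHS]mxE => e.
  transitivity (D%:~R * \sum_j B l j * A j (enum_rank k)); last by rewrite e mulr0.
  rewrite -sum_enum_rank mulr_sumr; apply: eq_bigr => i _.
  by rewrite rmorphM/= bE AE mulrC mulrA.
pose r : 'rV[R]_#|I| := \row_i d (enum_val i).
have : (r <= kermx (map_mx (ratr : rat -> R) A))%MS.
  apply/sub_kermxP/rowP => k; rewrite !mxE -[RHS](hd (enum_val k)) -[RHS]sum_enum_val.
  by apply: eq_bigr => i _; rewrite !mxE ratr_int mulrC.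
rewrite -map_kermx => /submxP[m rE].
exists (fun l => m 0 l / D%:~R) => i.
have /rowP/(_ (enum_rank i)) := rE; rewrite !mxE enum_rankK => ->.
apply: eq_bigr => l _; rewrite mxE -(ratr_int R (b l i)) bE rmorphM/= ratr_int.
by rewrite [RHS]mulrA divfK// intr_eq0.
Qed.

(** The real coefficients on an integral spanning family are rounded down; the error is at most the
    sum of the absolute values of all entries of the family, whatever [d] is. *)
Lemma int_kernel_approx (I K : finType) (C : K -> I -> int) (R : archiRealFieldType) :
  exists2 B : R, 0 <= B &
  forall d : I -> R, (forall k, \sum_i (C k i)%:~R * d i = 0) ->
    exists2 h : I -> int, (forall k, \sum_i C k i * h i = 0) &
      forall i, `|d i - (h i)%:~R| <= B.
Proof.
have [b [hb hd]] := int_kernel_basis C R.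
exists (\sum_l \sum_i `|(b l i)%:~R|) => [|d /hd[e dE]].
  by apply: sumr_ge0 => l _; apply: sumr_ge0.
exists (fun i => \sum_l Num.floor (e l) * b l i) => [k|i].
  under eq_bigr => i _ do rewrite mulr_sumr.
  rewrite exchange_big/= big1// => l _.
  under eq_bigr => i _ do rewrite mulrCA.
  by rewrite -mulr_sumr hb mulr0.
rewrite dE rmorph_sum/= -sumrB.
apply: le_trans (ler_norm_sum _ _ _) _; apply: ler_sum => l _.
rewrite rmorphM/= -mulrBl normrM (bigD1 i)//= -[leLHS]addr0 lerD//; last first.
  exact: sumr_ge0.
rewrite ler_piMl// ger0_norm ?subr_ge0 ?floor_le//.
by rewrite lerBlDl ltW// (lt_le_trans (floorD1_gt _))// intrD addrC.
Qed.

(** * Maximum of the entropy on a polytope *)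

Lemma cvg_sumr (R : realType) (I : finType) (T : Type) (F : set_system T)
    (f : I -> T -> R) (l : I -> R) : Filter F ->
  (forall i, f i x @[x --> F] --> l i) ->
  \sum_i f i x @[x --> F] --> \sum_i l i.
Proof. by move=> FF h; apply: cvg_big => //; exact: add_continuous. Qed.

Section EntropyMax.
Context {R : realType} {I K : finType} (C : K -> I -> int) (v : I -> nat) (L : R).
Implicit Types X d : I -> R.

Definition mean (w : I -> nat) X : R := \sum_i (w i)%:R * X i.

Definition feasible (r : K -> R) X : Prop :=
  (forall i, 0 <= X i) /\ forall k, \sum_i (C k i)%:~R * X i = r k.

(* The last two terms are [- L * H(mean v X / L)] up to a constant, with [H] the
   binary entropy. *)
Definition entropy X : R :=
  \sum_i eta (X i) - eta (mean v X) - eta (L - mean v X).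

Lemma mean_move w X d e : mean w (fun i => X i + e * d i) = mean w X + e * mean w d.
Proof.
by rewrite /mean mulr_sumr -big_split/=; apply: eq_bigr => i _; rewrite mulrDr mulrCA.
Qed.

Lemma feasible_move r X d e : feasible r X -> (forall k, \sum_i (C k i)%:~R * d i = 0) ->
  (forall i, 0 <= X i + e * d i) -> feasible r (fun i => X i + e * d i).
Proof.
move=> [_ hX] hd h0; split=> // k; under eq_bigr do rewrite mulrDr mulrCA.
by rewrite big_split/= hX -mulr_sumr hd mulr0 addr0.
Qed.

(* The two convex terms are bounded below by their tangents, so that no
   second order loss comes from them. *)
Lemma entropy_move_ge X d e (k : I -> R) : 0 < mean v X < L ->
  0 <= mean v (fun i => X i + e * d i) <= L ->
  (forall i, eta (X i) + e * k i <= eta (X i + e * d i)) ->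
  entropy X + e * (\sum_i k i + mean v d * (ln (mean v X) - ln (L - mean v X)))
    <= entropy (fun i => X i + e * d i).
Proof.
move=> /andP[b0 bL] /andP[c0 cL] h; rewrite /entropy.
have : \sum_i eta (X i) + e * \sum_i k i <= \sum_i eta (X i + e * d i).
  by rewrite mulr_sumr -big_split/=; exact: ler_sum.
have t1 := eta_le_tangent b0 c0.
have L0 : 0 < L - mean v X by rewrite subr_gt0.
have := @eta_le_tangent _ _ (L - mean v (fun i => X i + e * d i)) L0.
rewrite subr_ge0 => /(_ cL); move: t1; rewrite mean_move; lra.
Qed.

Lemma entropy_continuous (V : topologicalType) (X : V -> I -> R) :
  (forall i, continuous (fun t => X t i)) -> continuous (fun t => entropy (X t)).
Proof.
move=> cX; have cm : continuous (fun t => mean v (X t)).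
  move=> t; apply: cvg_sumr => i.
  by apply: cvgM; [exact: cvg_cst|exact: cX].
move=> t; apply: cvgB; first apply: cvgB.
- apply: cvg_sumr => i; apply: continuous_comp; [exact: cX|exact: continuous_eta].
- by apply: continuous_comp; [exact: cm|exact: continuous_eta].
- apply: (@continuous_comp _ _ _ (fun t => L - mean v (X t))); last exact: continuous_eta.
  by apply: cvgB; [exact: cvg_cst|exact: cm].
Qed.

(** The feasible set is closed and lies in a cube, hence is compact, and [entropy] is continuous.
    Functions on [I] are transported to row vectors to speak of compactness. *)
Lemma entropy_argmax (r : K -> R) X0 M : feasible r X0 ->
  (forall X, feasible r X -> forall i, X i <= M) ->
  exists2 X, feasible r X & forall Y, feasible r Y -> entropy Y <= entropy X.
Proof.
move=> fX0 hM.
pose f (p : 'rV[R]_#|I|) i := p ord0 (enum_rank i).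
pose g X : 'rV[R]_#|I| := \row_j X (enum_val j).
have fg X : f (g X) = X by apply/funext => i; rewrite /f mxE enum_rankK.
have cf i : continuous (fun p => f p i) by exact: coord_continuous.
pose A := [set p | feasible r (f p)].
have clA : closed A.
  have -> : A = (\bigcap_(i in setT) ((fun p => f p i) @^-1` [set x | 0 <= x])) `&`
     (\bigcap_(k in setT) ((fun p => \sum_i (C k i)%:~R * f p i) @^-1` [set x | x = r k])).
    by apply/seteqP; split=> p /= [h1 h2]; split=> // i;
      [move=> _; exact: h1|move=> _; exact: h2|exact: h1|exact: h2].
  apply: closedI; apply: closed_bigI => i _.
    by apply: preimage_closed; [move=> p _; exact: cf|exact: closed_ge].
  apply: preimage_closed; [move=> p _|exact: closed_eq].
  apply: (@cvg_sumr _ _ _ (nbhs p)) => j.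
  by apply: cvgM; [exact: cvg_cst|exact: cf].
have cA : compact A.
  pose B := [set p : 'rV[R]_#|I| | forall j, `[0, M]%classic (p ord0 j)].
  have cB : compact B by apply: (@rV_compact _ _ (fun=> `[0, M]%classic)) => j; exact: segment_compact.
  apply: (subclosed_compact clA cB).
  move=> p fp j; rewrite /= in_itv/= -(enum_valK j).
  by rewrite (fp.1 (enum_val j)) (hM _ fp (enum_val j)).
have [||p] := @compact_EVT_max _ R (entropy \o f) A _ cA.
- by exists (g X0); rewrite /A/= fg.
- by apply: continuous_subspaceT => p; exact: entropy_continuous.
rewrite inE => fp hp; exists (f p) => // Y fY.
by have := hp (g Y); rewrite inE /A/= fg; exact.
Qed.

(** A step [e] from [X] towards [X0] gains order [e ln (1 / e)] at a zero coordinate where [X0] is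
    positive, while all other changes are at worst of order [e]; at a maximizer this is
    impossible. *)
Lemma entropy_argmax_gt0 (r : K -> R) X0 X : feasible r X0 -> feasible r X ->
  (forall Y, feasible r Y -> entropy Y <= entropy X) ->
  (forall Y, feasible r Y -> 0 < mean v Y <= L) -> mean v X < L ->
  forall i, 0 < X0 i -> 0 < X i.
Proof.
move=> f0 fX hX hm bL i i0; rewrite lt0r (fX.1 i) andbT; apply/negP => /eqP Xi0.
pose d j := X0 j - X j.
have hd k : \sum_j (C k j)%:~R * d j = 0.
  under eq_bigr do rewrite mulrBr.
  by rewrite sumrB f0.2 fX.2 subrr.
have bX : 0 < mean v X < L by rewrite bL andbT; case/andP: (hm _ fX).
pose k0 j := eta (X0 j) - eta (X j).
pose G := \sum_j k0 j + mean v d * (ln (mean v X) - ln (L - mean v X)).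
(* With [e = expR (- y)] the extra gain at [i] is exactly [e * X0 i * y]; this [y] makes [X0 i * y]
   exceed the absolute value of [G], the first order coefficient of all the rest. *)
pose y := (`|G| + 1) / X0 i.
have y0 : 0 < y by rewrite divr_gt0// ltr_wpDl.
pose e := expR (- y).
have e01 : 0 <= e <= 1 by rewrite expR_ge0/= -expR0 ler_expR oppr_le0 ltW.
have hge j : 0 <= X j + e * d j.
  have -> : X j + e * d j = (1 - e) * X j + e * X0 j by rewrite /d; ring.
  by rewrite addr_ge0// mulr_ge0 ?subr_ge0 ?fX.1 ?f0.1//; case/andP: e01.
have fe := feasible_move fX hd hge.
(* Concavity gives the chord slope [k0] at every coordinate; at [i] the logarithmic gain is
   added. *)
pose k j := k0 j + if j == i then X0 i * y else 0.
have := @entropy_move_ge X d e k bX.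
case/andP: (hm _ fe) => /ltW -> -> /(_ isT) h.
have : entropy X + e * (\sum_i k i + mean v d * (ln (mean v X) - ln (L - mean v X)))
    <= entropy X.
  apply: le_trans (hX _ fe); apply: h => j; rewrite /k; have [->|_] := eqVneq j i.
    rewrite Xi0 eta0 !add0r /d Xi0 subr0 etaM ?expR_gt0 ?f0.1// expRK /k0 Xi0 eta0.
    by rewrite le_eqVlt; apply/orP; left; apply/eqP; ring.
  rewrite addr0 /k0 /d; apply: eta_concave => //; [exact: fX.1|exact: f0.1].
apply/negP; rewrite -ltNge ltrDl mulr_gt0 ?expR_gt0// /k big_split/= -big_mkcond/= big_pred1_eq.
rewrite /y mulrCA divff ?gt_eqF// mulr1 addrAC -/G.
have := lerNnormlW (lexx `|G|); lra.
Qed.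

(** By the second hypothesis kernel directions do not touch zero coordinates, so small moves along
    both [d] and [- d] stay feasible. The derivative of [entropy] at the maximizer then vanishes on
    the kernel, and so is a combination of the constraints. *)
Lemma entropy_argmax_lagrange (r : K -> R) X : feasible r X ->
  (forall d, (forall k, \sum_i (C k i)%:~R * d i = 0) ->
    forall i, X i = 0 -> d i = 0) ->
  (forall Y, feasible r Y -> entropy Y <= entropy X) ->
  (forall Y, feasible r Y -> 0 < mean v Y <= L) -> mean v X < L ->
  exists mu : K -> R, forall i, 0 < X i ->
    ln (X i) + 1 - (v i)%:R * (ln (mean v X) - ln (L - mean v X)) =
    \sum_k mu k * (C k i)%:~R.
Proof.
move=> fX dX hX hm bL.
have bX : 0 < mean v X < L by rewrite bL andbT; case/andP: (hm _ fX).
pose ell := ln (mean v X) - ln (L - mean v X).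
pose g i := if 0 < X i then ln (X i) + 1 - (v i)%:R * ell else 0.
have key d : (forall k, \sum_i (C k i)%:~R * d i = 0) -> 0 <= \sum_i g i * d i.
  move=> hd; rewrite leNgt; apply/negP => s0.
  pose S := \sum_i d i ^+ 2 / X i.
  have S0 : 0 <= S by apply: sumr_ge0 => i _; rewrite mulr_ge0 ?sqr_ge0 ?invr_ge0 ?fX.1.
  pose s := - \sum_i g i * d i.
  have {}s0 : 0 < s by rewrite oppr_gt0.
  pose N := 1 + \sum_i `|d i| / X i.
  have hN i : `|d i| / X i <= N.
    rewrite /N (bigD1 i)//= addrCA lerDl addr_ge0// sumr_ge0// => j _.
    by rewrite mulr_ge0// invr_ge0 fX.1.
  have N1 : 1 <= N by rewrite lerDl sumr_ge0// => j _; rewrite mulr_ge0// invr_ge0 fX.1.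
  have N0 : 0 < N by exact: lt_le_trans N1.
  (* The bound [N^-1] keeps all coordinates nonnegative; the bound [s / (S + 1)] makes the first
     order gain [s] beat the second order loss [e * S]. *)
  pose e := Num.min N^-1 (s / (S + 1)).
  have S1 : 0 < S + 1 by rewrite ltr_wpDl.
  have e0 : 0 < e by rewrite lt_min invr_gt0 N0 divr_gt0.
  have he i : 0 <= X i + e * d i.
    have := fX.1 i; rewrite le_eqVlt => /predU1P[xi|xi].
      by rewrite -xi (dX d hd i (esym xi)) mulr0 addr0.
    have : e * `|d i| <= X i.
      have : `|d i| <= N * X i by rewrite -ler_pdivrMr.
      have : e * N <= 1 by rewrite -ler_pdivlMr// mul1r /e ge_min lexx.
      move=> h1 h2; apply: le_trans (ler_wpM2l (ltW e0) h2) _.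
      by rewrite mulrA ler_piMl// ltW.
    have : e * - `|d i| <= e * d i by rewrite ler_pM2l// lerNnormlW.
    by rewrite mulrN; lra.
  have fe := feasible_move fX hd he.
  pose k i := (if 0 < X i then - d i * (ln (X i) + 1) else 0) - e * (d i ^+ 2 / X i).
  have := @entropy_move_ge X d e k bX.
  case/andP: (hm _ fe) => /ltW -> -> /(_ isT) h.
  have : entropy X + e * (\sum_i k i + mean v d * ell) <= entropy X.
    apply: le_trans (hX _ fe); apply: h => i; rewrite /k; case: ltrP => xi.
      apply: le_trans (eta_ge_tangent xi (he i)).
      by rewrite le_eqVlt; apply/orP; left; apply/eqP; ring.
    have xi0 : X i = 0 by apply/eqP; rewrite eq_le xi (fX.1 i).
    by rewrite (dX d hd i xi0) xi0 expr0n/= !(mul0r, mulr0, subrr, addr0).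
  apply/negP; rewrite -ltNge ltrDl mulr_gt0//.
  rewrite (_ : _ + _ = s - e * S).
    rewrite subr_gt0; apply: (@le_lt_trans _ _ (s / (S + 1) * S)).
      by rewrite ler_wpM2r// /e ge_min lexx orbT.
    by rewrite -mulrA gtr_pMr// mulrC ltr_pdivrMr// mul1r ltrDl.
  rewrite /s /S /mean mulr_sumr mulr_suml -big_split -sumrN -sumrB/=.
  apply: eq_bigr => i _; rewrite /k /g; case: ltrP => xi; first by ring.
  have xi0 : X i = 0 by apply/eqP; rewrite eq_le xi (fX.1 i).
  by rewrite (dX d hd i xi0); ring.
have [d hd|mu hmu] := @lin_comb_of_kernel R I K (fun k i => (C k i)%:~R) g.
  apply/eqP; rewrite eq_le key// andbT -oppr_ge0 -sumrN.
  under eq_bigr do rewrite -mulrN.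
  apply: (key (fun i => - d i)) => k /=.
  by under eq_bigr do rewrite mulrN; rewrite sumrN hd oppr0.
by exists mu => i xi; rewrite -hmu /g xi.
Qed.

(** It suffices to compare [X0] with one maximizer. Either its mean is [L], or it has the support of
    [X0] and satisfies the Lagrange equations; the last two hypotheses settle these cases. *)
Theorem entropy_max (r : K -> R) X0 M : feasible r X0 ->
  (forall X, feasible r X -> forall i, X i <= M) ->
  (forall d, (forall k, \sum_i (C k i)%:~R * d i = 0) ->
    forall i, X0 i = 0 -> d i = 0) ->
  (forall X, feasible r X -> 0 < mean v X <= L) ->
  (forall X, feasible r X -> mean v X = L -> entropy X <= entropy X0) ->
  (forall X mu, feasible r X -> (forall i, X0 i = 0 -> X i = 0) ->
    (forall i, 0 < X0 i -> 0 < X i) -> mean v X < L ->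
    (forall i, 0 < X i ->
      ln (X i) + 1 - (v i)%:R * (ln (mean v X) - ln (L - mean v X)) =
      \sum_k mu k * (C k i)%:~R) -> entropy X <= entropy X0) ->
  forall X, feasible r X -> entropy X <= entropy X0.
Proof.
move=> f0 hM dX0 hm hbd hcr Y fY.
have [X fX hX] := entropy_argmax f0 hM.
apply: le_trans (hX _ fY) _.
have [/andP[_]] := hm _ fX; rewrite le_eqVlt => /predU1P[|bL]; first exact: hbd.
have pX := entropy_argmax_gt0 f0 fX hX hm bL.
have zX i : X0 i = 0 -> X i = 0.
  move=> i0; have := dX0 (fun i => X i - X0 i) _ i i0; rewrite i0 subr0; apply=> k.
  under eq_bigr do rewrite mulrBr.
  by rewrite sumrB f0.2 fX.2 subrr.
have [d hd i xi|mu hmu] := entropy_argmax_lagrange fX _ hX hm bL.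
  apply: dX0 => //; apply/eqP; have := f0.1 i; rewrite le_eqVlt eq_sym => /predU1P[->//|/pX].
  by rewrite xi ltxx.
exact: (hcr X mu).
Qed.

End EntropyMax.

(** * Sums over types *)

Section TypeSums.
Context {R : realType} {A I T : finType} (phi : A -> T) (psi : I -> T).

Definition type_of (F : {ffun A -> I}) : {ffun I -> nat} := [ffun i => #|fiber F i|].

Definition compat (F : {ffun A -> I}) : bool := [forall a, psi (F a) == phi a].

(** A product of multinomial coefficients, one for each [t]. *)
Definition class_size (N : I -> nat) : R :=
  (\prod_t (#|fiber phi t|)`!%:R) / (\prod_i (N i)`!%:R).

Lemma sum_type_of (w : I -> nat) (F : {ffun A -> I}) : (\sum_a w (F a) = \sum_i w i * type_of F i)%N.
Proof.
rewrite (partition_big F xpredT)//=; apply: eq_bigr => i _.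
rewrite (eq_bigr (fun _ => w i)); last by move=> a /eqP ->.
by rewrite sum_nat_const mulnC ffunE; congr (_ * _)%N; apply: eq_card => a; rewrite !inE.
Qed.

Lemma type_of_compat F : compat F ->
  forall t, (\sum_(i | psi i == t) type_of F i = #|fiber phi t|)%N.
Proof.
move=> /forallP cF t; rewrite big_mkcond/=.
have := sum_type_of (fun i => psi i == t) F => e.
transitivity (\sum_i (psi i == t) * type_of F i)%N.
  by apply: eq_bigr => i _; case: eqP; rewrite ?mul1n ?mul0n.
rewrite -e -sum1_card big_mkcond [RHS]big_mkcond/=; apply: eq_bigr => a _.
by rewrite inE (eqP (cF a)); case: eqP.
Qed.

Lemma card_class (N : {ffun I -> nat}) :
  (forall t, (\sum_(i | psi i == t) N i = #|fiber phi t|)%N) ->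
  #|[set F | compat F && (type_of F == N)]%SET|%:R = class_size N.
Proof.
move=> hN; rewrite /class_size -[\prod_t _]natr_prod -[\prod_i _]natr_prod.
rewrite -(card_type_class hN) natrM mulfK; last first.
  by rewrite pnatr_eq0 -lt0n prodn_gt0// => i; exact: fact_gt0.
congr (_%:R); apply: eq_card => F; rewrite !inE; congr andb.
apply/eqP/forallP => [<- i|h]; first by rewrite ffunE.
by apply/ffunP => i; rewrite ffunE (eqP (h i)).
Qed.

Lemma sum_types_ge (Q : pred {ffun I -> nat}) (G : {ffun I -> nat} -> R)
    (N : {ffun I -> nat}) :
  (forall N, 0 <= G N) -> Q N ->
  (forall t, (\sum_(i | psi i == t) N i = #|fiber phi t|)%N) ->
  class_size N * G N <= \sum_(F | compat F && Q (type_of F)) G (type_of F).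
Proof.
move=> G0 QN hN; rewrite -card_class// -sum1dep_card natr_sum mulr_suml.
rewrite big_mkcond [leRHS]big_mkcond/=; apply: ler_sum => F _.
case: ifPn => [/andP[-> /eqP ->]|_]; first by rewrite QN mul1r.
by case: ifP.
Qed.

(** Each type contributes at most [B], and a type is a function from [I] to numbers that are at most
    [#|A|]. *)
Lemma sum_types_le (Q : pred {ffun I -> nat}) (G : {ffun I -> nat} -> R) (B : R) :
  0 <= B ->
  (forall N : {ffun I -> nat}, Q N ->
     (forall t, (\sum_(i | psi i == t) N i = #|fiber phi t|)%N) ->
     class_size N * G N <= B) ->
  \sum_(F | compat F && Q (type_of F)) G (type_of F) <= (#|A|.+1 ^ #|I|)%:R * B.
Proof.
move=> B0 hB.
(* Types are recoded with bounded values, so that they range over a finite type and can be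
   counted. *)
pose tF (F : {ffun A -> I}) : {ffun I -> 'I_#|A|.+1} := [ffun i => inord #|fiber F i|].
have tE F i : tF F i = type_of F i :> nat.
  by rewrite !ffunE inordK// ltnS max_card.
rewrite (partition_big tF xpredT)//=.
apply: (@le_trans _ _ (\sum_(N : {ffun I -> 'I_#|A|.+1}) B)); last first.
  by rewrite sumr_const card_ffun card_ord mulr_natl.
apply: ler_sum => N _; pose N' : {ffun I -> nat} := [ffun i => N i : nat].
have tN F : (tF F == N) = (type_of F == N').
  apply/eqP/eqP => h; apply/ffunP => i; first by rewrite [RHS]ffunE -h tE.
  by apply/val_inj; rewrite /= tE h ffunE.
have [[F /and3P[cF qF /eqP e]]|no] :=
  pselect (exists F, [&& compat F, Q (type_of F) & tF F == N]); last first.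
  rewrite big1// => F hF; case: no; exists F; by rewrite andbA.
have {}e : type_of F = N' by apply/eqP; rewrite -tN e.
apply: le_trans (hB N' _ _); last 2 first.
- by rewrite -e.
- by move=> t; rewrite -e type_of_compat.
rewrite -card_class; last by move=> t; rewrite -e type_of_compat.
rewrite -sum1dep_card natr_sum mulr_suml le_eqVlt; apply/orP; left; apply/eqP.
apply: eq_big => [F'|F' /andP[_]]; last by rewrite tN => /eqP ->; rewrite mul1r.
by rewrite tN; case: eqP => [->|]; rewrite ?andbF// -e qF !andbT.
Qed.

End TypeSums.

(** * Stirling estimate for the contribution of one type *)

Section ClassTerm.
Context {R : realType} {I T : finType} (v : I -> nat).

(** The rate per variable node of [class_size] times the probability [1 / 'C(E, j)]: [D] stands for
    the node densities, [L] for the edge density and [mean v X] for the density of ones. *)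
Definition growth_exponent (D : T -> R) (L : R) (X : I -> R) : R :=
  entropy v L X - \sum_t eta (D t) + eta L.

(** Homogeneity of degree one. The terms with [ln s] cancel: those of [X] against those of [D],
    which have the same total, and those of the two edge terms against that of [L]. *)
Lemma growth_exponent_scale (s : R) D L X : 0 < s ->
  (forall t, 0 <= D t) -> (forall i, 0 <= X i) -> 0 <= mean v X <= L ->
  \sum_i X i = \sum_t D t ->
  growth_exponent (fun t => s * D t) (s * L) (fun i => s * X i) =
  s * growth_exponent D L X.
Proof.
move=> s0 D0 X0 /andP[b0 bL] hXD; rewrite /growth_exponent /entropy.
have -> : mean v (fun i => s * X i) = s * mean v X.
  by rewrite /mean mulr_sumr; apply: eq_bigr => i _; rewrite mulrCA.
rewrite -mulrBr !etaM// ?subr_ge0//; last exact: le_trans bL.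
under eq_bigr do rewrite etaM//.
under [X in _ - X + _]eq_bigr do rewrite etaM//.
rewrite !sumrB -!mulr_sumr -!mulr_suml -!mulr_sumr hXD.
by ring.
Qed.

Lemma sum_fact_err_bound (J : finType) (f : J -> nat) (x : R) :
  (forall j, (f j)%:R <= x) ->
  0 <= \sum_j (fact_err (f j) : R) <= #|J|%:R * (1 + ln (x + 1)).
Proof.
move=> h; rewrite sumr_ge0/= => [|j _]; last exact: fact_err_ge0.
rewrite mulr_natl -sumr_const; apply: ler_sum => j _; exact: fact_err_le.
Qed.

Lemma ln_prod_fact (J : finType) (f : J -> nat) :
  ln (\prod_j (f j)`!%:R) = \sum_j (fact_err (f j) - eta (f j)%:R - (f j)%:R) :> R.
Proof.
pose P (x y : R) := 0 < x /\ ln x = y.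
apply: (proj2 (_ : P _ _)); apply: (big_ind2 P); rewrite /P.
- by rewrite ltr01 ln1.
- by move=> x1 y1 x2 y2 [x10 <-] [x20 <-]; rewrite mulr_gt0// lnM.
- by move=> j _; rewrite natr_fact_gt0; split=> //; rewrite /fact_err; ring.
Qed.

(** Every factorial is replaced by its Stirling approximation. The linear terms cancel because the
    totals agree; the 3 in the bound counts the factorials of [j], [E - j] and [E]. *)
Lemma ln_class_term (m : T -> nat) (E j : nat) (N : I -> nat) (x : R) :
  (j <= E)%N -> (\sum_i N i = \sum_t m t)%N -> j = (\sum_i v i * N i)%N ->
  (forall t, (m t)%:R <= x) -> (forall i, (N i)%:R <= x) -> E%:R <= x ->
  `| ln ((\prod_t (m t)`!%:R) / (\prod_i (N i)`!%:R) *
         (j`!%:R * (E - j)`!%:R / E`!%:R)) -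
     growth_exponent (fun t => (m t)%:R) E%:R (fun i => (N i)%:R) | <=
  (#|T|%:R + #|I|%:R + 3) * (1 + ln (x + 1)) :> R.
Proof.
move=> jE hNm jN hm hN hE.
have x0 : 0 <= x by apply: le_trans hE.
have l0 : 0 <= ln (x + 1) by rewrite ln_ge0// lerDr.
have pf (J : finType) (f : J -> nat) : 0 < \prod_j (f j)`!%:R :> R.
  by rewrite prodr_gt0// => k _; exact: natr_fact_gt0.
rewrite lnM ?posrE ?divr_gt0 ?mulr_gt0 ?natr_fact_gt0//.
rewrite !ln_div ?posrE ?mulr_gt0 ?natr_fact_gt0// lnM ?posrE ?natr_fact_gt0//.
rewrite !ln_prod_fact.
have mE : mean v (fun i => (N i)%:R) = j%:R :> R.
  by rewrite /mean jN natr_sum; apply: eq_bigr => i _; rewrite natrM.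
have lf k : ln k`!%:R = fact_err k - eta k%:R - k%:R :> R by rewrite /fact_err; ring.
rewrite /growth_exponent /entropy mE -natrB// !lf !sumrB.
have -> : \sum_i (N i)%:R = \sum_t (m t)%:R :> R by rewrite -!natr_sum hNm.
have /andP[a1 a2] := @sum_fact_err_bound T m x hm.
have /andP[b1 b2] := @sum_fact_err_bound I N x hN.
have jx : j%:R <= x :> R by apply: le_trans hE; rewrite ler_nat.
have ejx : (E - j)%N%:R <= x :> R by apply: le_trans hE; rewrite ler_nat leq_subr.
have c1 := @fact_err_ge0 R j; have c2 := fact_err_le jx.
have d1 := @fact_err_ge0 R (E - j)%N; have d2 := fact_err_le ejx.
have e1 := @fact_err_ge0 R E; have e2 := fact_err_le hE.
have n1 : (E - j)%N%:R = E%:R - j%:R :> R by rewrite natrB.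
have T0 : 0 <= #|T|%:R * (1 + ln (x + 1)) by rewrite mulr_ge0// addr_ge0.
have I0 : 0 <= #|I|%:R * (1 + ln (x + 1)) by rewrite mulr_ge0// addr_ge0.
by rewrite ler_norml n1 !mulrDl; apply/andP; split; lra.
Qed.

End ClassTerm.

(** * Limits of exponents *)

Section Limits.
Context {R : realType}.

Lemma cvg_invn : (n%:R^-1 : R) @[n --> \oo] --> (0 : R).
Proof.
by rewrite -cvg_shiftS; exact: cvg_harmonic.
Qed.

(** Since [ln u <= 2 * Num.sqrt u], the quotient is of order [1 / Num.sqrt n]. *)
Lemma cvg_log_over_n (c k : R) : 0 <= k ->
  c * (1 + ln (k * n%:R + 1)) / n%:R @[n --> \oo] --> (0 : R).
Proof.
move=> k0; rewrite -(mulr0 c).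
under eq_fun do rewrite -mulrA.
apply: cvgM; first exact: cvg_cst.
have h : n%:R^-1 + 2 * Num.sqrt (k + 1) * Num.sqrt n%:R^-1 @[n --> \oo] --> (0 : R).
  rewrite -[X in _ --> X]addr0; apply: cvgD; first exact: cvg_invn.
  rewrite -[X in _ --> X](mulr0 (2 * Num.sqrt (k + 1))) -[in X in _ --> X](@sqrtr0 R).
  apply: cvgM; first exact: cvg_cst.
  apply: continuous_cvg; [exact: sqrt_continuous|exact: cvg_invn].
apply: (@squeeze_cvgr _ _ _ _ (fun=> 0)
  (fun n => n%:R^-1 + 2 * Num.sqrt (k + 1) * Num.sqrt n%:R^-1)) => //; last exact: cvg_cst.
near=> n.
have n_gt0 : (0 < n)%N by near: n; exact: nbhs_infty_gt.
have nR : 0 < n%:R :> R by rewrite ltr0n.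
have n1 : 1 <= n%:R :> R by rewrite ler1n.
have kn : 0 <= k * n%:R by rewrite mulr_ge0.
rewrite divr_ge0 ?addr_ge0 ?ln_ge0 ?lerDr//= mulrDl mul1r lerD2l.
have h1 : ln (k * n%:R + 1) <= 2 * Num.sqrt ((k + 1) * n%:R).
  apply: le_trans (ln_le_2sqrt _) _; first by rewrite ltr_wpDl.
  by rewrite ler_wpM2l// ler_wsqrtr// mulrDl mul1r lerD2l.
rewrite ler_pdivrMr//; apply: le_trans h1 _.
rewrite sqrtrM ?addr_ge0// -!mulrA ler_wpM2l// ler_wpM2l ?sqrtr_ge0//.
rewrite sqrtrV// -{3}(sqr_sqrtr (ltW nR)) expr2 mulKf// gt_eqF// sqrtr_gt0//.
Unshelve. all: by end_near. Qed.

End Limits.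

(** The difference of [n * X0] and one integral solution [N1] is in the kernel; an integral kernel
    vector [h] near it gives the solution [N1 + h] at bounded distance from [n * X0]. The second
    hypothesis leaves the zero coordinates of [X0] at zero under [h]. *)
Lemma near_integer_point (R : realType) (I K : finType) (C : K -> I -> int)
    (r : K -> R) (X0 : I -> R) :
  feasible C r X0 ->
  (forall d : I -> R, (forall k, \sum_i (C k i)%:~R * d i = 0) ->
    forall i, X0 i = 0 -> d i = 0) ->
  exists B n0, forall n (N1 : I -> nat), (n0 <= n)%N -> (0 < n)%N ->
    (forall k, \sum_i (C k i)%:~R * (N1 i)%:R = n%:R * r k) ->
    exists2 N : I -> nat,
      (forall k, \sum_i (C k i)%:~R * (N i)%:R = n%:R * r k) &
      (forall i, `|(N i)%:R / n%:R - X0 i| <= B / n%:R).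
Proof.
move=> fX dX; have [B B0 hB] := int_kernel_approx C R.
(* The sum dominates each ceiling, so [n0 <= n] gives [B <= n * X0 i] wherever [X0 i] is positive,
   and [N1 + h] is nonnegative there. *)
pose n0 := (\sum_i `|Num.ceil (B / X0 i)|)%N.
exists B, n0 => n N1 n0n n_gt0 hN1.
have nR : 0 < n%:R :> R by rewrite ltr0n.
have hd k : \sum_i (C k i)%:~R * (n%:R * X0 i - (N1 i)%:R) = 0.
  under eq_bigr do rewrite mulrBr mulrCA.
  by rewrite sumrB -mulr_sumr fX.2 hN1 subrr.
have [h hk hh] := hB _ hd.
have hkR k : \sum_i (C k i)%:~R * (h i)%:~R = 0 :> R.
  rewrite (eq_bigr (fun i => (C k i * h i)%:~R)); last by move=> i _; rewrite intrM.
  by rewrite -[LHS](rmorph_sum (intr : int -> R)) hk.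
have pos i : 0 <= (N1 i)%:Z + h i.
  have [i0|i0] := eqVneq (X0 i) 0.
    have /eqP := dX _ hkR i i0; rewrite intr_eq0 => /eqP ->.
    by rewrite addr0.
  have {}i0 : 0 < X0 i by rewrite lt_neqAle eq_sym i0 fX.1.
  rewrite -(ler0z R) intrD.
  have : B <= n%:R * X0 i.
    rewrite -ler_pdivrMr//; apply: le_trans (ceil_ge _) _.
    have c0 : 0 <= Num.ceil (B / X0 i) by rewrite ceil_ge0 (lt_le_trans (ltrN10 _))// divr_ge0// ltW.
    rewrite -(gez0_abs c0) -[n%:R]/((n%:Z)%:~R) ler_int lez_nat.
    by apply: leq_trans n0n; rewrite /n0 (bigD1 i)//= leq_addr.
  have := lerNnormlW (hh i); move: (hh i); rewrite ler_norml => /andP[h1 h2] _.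
  rewrite -[(N1 i)%:~R]/((N1 i)%:R); lra.
exists (fun i => `|((N1 i)%:Z + h i)%R|%N) => [k|i].
  under eq_bigr => i _ do rewrite natr_absz ger0_norm// intrD mulrDr.
  by rewrite big_split/= hkR addr0 -hN1.
rewrite natr_absz (ger0_norm (pos i)) intrD -[(N1 i)%:~R]/((N1 i)%:R).
have -> : ((N1 i)%:R + (h i)%:~R) / n%:R - X0 i =
    - (n%:R * X0 i - (N1 i)%:R - (h i)%:~R) / n%:R by field; rewrite gt_eqF.
by rewrite normrM normrN (gtr0_norm (x := n%:R^-1)) ?invr_gt0// ler_wpM2r// invr_ge0 ltW.
Qed.

(** * Passage to the limit *)

Section GrowthLimit.
Context {R : realType} {I T : finType} (v : I -> nat) (D : T -> R) (L : R).

Lemma growth_exponent_cvg (X : nat -> I -> R) (X0 : I -> R) (F : set_system nat) :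
  Filter F -> (forall i, X n i @[n --> F] --> X0 i) ->
  growth_exponent v D L (X n) @[n --> F] --> growth_exponent v D L X0.
Proof.
move=> FF hX.
have cm : mean v (X n) @[n --> F] --> mean v X0.
  by apply: cvg_sumr => i; apply: cvgM; [exact: cvg_cst|exact: hX].
apply: cvgD; last exact: cvg_cst.
apply: cvgB; last exact: cvg_cst.
apply: cvgB; first apply: cvgB.
- by apply: cvg_sumr => i; apply: continuous_cvg; [exact: continuous_eta|exact: hX].
- by apply: continuous_cvg; [exact: continuous_eta|exact: cm].
- apply: continuous_cvg; first exact: continuous_eta.
  by apply: cvgB; [exact: cvg_cst|exact: cm].
Qed.

(** A squeeze: the lower bound is taken at points that tend to [X0], where the exponent is
    continuous, and both errors are logarithmic. *)
Lemma growth_limit (S : set nat) (a : nat -> R) (X0 : I -> R) (c1 c2 k B : R) (n0 : nat) :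
  0 <= k ->
  (forall n, S n -> (0 < n)%N ->
    ln (a n) <= n%:R * growth_exponent v D L X0 + c1 * (1 + ln (k * n%:R + 1))) ->
  (forall n, S n -> (n0 <= n)%N -> (0 < n)%N ->
    exists2 X : I -> R, (forall i, `|X i - X0 i| <= B / n%:R) &
      n%:R * growth_exponent v D L X - c2 * (1 + ln (k * n%:R + 1)) <= ln (a n)) ->
  ln (a n) / n%:R @[n --> within S \oo] --> growth_exponent v D L X0.
Proof.
move=> k0 hup hlow.
pose P n (X : I -> R) := (forall i, `|X i - X0 i| <= B / n%:R) /\
  n%:R * growth_exponent v D L X - c2 * (1 + ln (k * n%:R + 1)) <= ln (a n).
(* The default [X0], where no witness exists, does not disturb the convergence to [X0]. *)
pose Xn n : I -> R := if pselect (exists X, P n X) is left e then projT1 (cid e) else X0.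
have XnP n : S n -> (n0 <= n)%N -> (0 < n)%N -> P n (Xn n).
  move=> Sn nn0 n_gt0; rewrite /Xn; case: pselect => [e|]; first by case: cid.
  by case; have [X h1 h2] := hlow n Sn nn0 n_gt0; exists X.
have Xn0 : forall i, Xn n i @[n --> within S \oo] --> X0 i.
  move=> i; apply: cvg_trans; first by apply: cvg_app; exact: cvg_within.
  apply/cvgrPdist_le => e e0; near=> n.
  have : `|Xn n i - X0 i| <= `|B| / n%:R.
    rewrite /Xn; case: pselect => [ex|_].
      by case: cid => X [/= h _]; apply: le_trans (h i) _; rewrite ler_wpM2r// ler_norm.
    by rewrite subrr normr0 divr_ge0.
  rewrite distrC => /le_trans; apply; near: n.
  have : `|B| / n%:R @[n --> \oo] --> (0 : R).
    by rewrite -(mulr0 `|B|); apply: cvgM; [exact: cvg_cst|exact: cvg_invn].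
  move=> /cvgr0Pnorm_le /(_ _ e0) h; apply: filterS h => n.
  exact: le_trans (ler_norm _).
pose err c n : R := c * (1 + ln (k * n%:R + 1)) / n%:R.
have cerr c : err c n @[n --> within S \oo] --> (0 : R).
  apply: cvg_trans; first by apply: cvg_app; exact: cvg_within.
  exact: cvg_log_over_n.
apply: (@squeeze_cvgr _ _ _ _ (fun n => growth_exponent v D L (Xn n) - err c2 n)
  (fun n => growth_exponent v D L X0 + err c1 n)).
- near=> n.
  have Sn : S n by near: n; exact: near_withinT.
  have n_gt0 : (0 < n)%N by near: n; apply: cvg_within; exact: nbhs_infty_gt.
  have nn0 : (n0 <= n)%N by near: n; apply: cvg_within; exact: nbhs_infty_ge.
  have nR : 0 < n%:R :> R by rewrite ltr0n.
  have eM (g e : R) : (g + e / n%:R) * n%:R = n%:R * g + e by field; rewrite gt_eqF.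
  rewrite /err ler_pdivlMr// ler_pdivrMr// -mulNr !eM hup// andbT.
  exact: (XnP n Sn nn0 n_gt0).2.
- rewrite -[X in _ --> X]subr0; apply: cvgB; last exact: cerr.
  exact: growth_exponent_cvg.
- rewrite -[X in _ --> X]addr0; apply: cvgD; last exact: cerr.
  exact: cvg_cst.
Unshelve. all: by end_near. Qed.

End GrowthLimit.

(** * Labellings of the nodes by local words *)

Lemma F2_eq_neq0 (a b : 'F_2) : (a == b) = ((a != 0) == (b != 0)).
Proof. by case: a b => [[|[|//]] ?] [[|[|//]] ?]. Qed.

Lemma hweight_tagged (V : finType) (len : V -> nat)
    (X : {v : V & 'I_(len v)} -> 'F_2) :
  #|[set s | X s != 0]%SET| =
  (\sum_(v : V) hweight (\row_(j < len v) X (Tagged (fun v => 'I_(len v)) j)))%N.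
Proof.
rewrite -sum1dep_card.
transitivity (\sum_(v : V) \sum_(j < len v | X (Tagged (fun v => 'I_(len v)) j) != 0%R) 1)%N.
  by rewrite sig_big_dep; apply: eq_bigl => -[].
by apply: eq_bigr => v _; rewrite sum1dep_card; apply: eq_card => j; rewrite !inE mxE.
Qed.

Section Labellings.
Context {R : realType} (M : ensemble R).

(** A check label is an arbitrary word, so that labels match pairs of unrestricted words and
    patterns; membership in the local code is the separate condition [codeword_label]. *)
Definition label : finType :=
  ({t : 'I_(nv M) & 'rV['F_2]_(vdim (vtype M t))} +
   {s : 'I_(nc M) & 'rV['F_2]_(clen (ctype M s))})%type.

Definition node_type : finType := ('I_(nv M) + 'I_(nc M))%type.

Definition vlabel t (m : 'rV['F_2]_(vdim (vtype M t))) : label :=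
  inl (Tagged (fun t => 'rV['F_2]_(vdim (vtype M t))) m).

Definition clabel s (c : 'rV['F_2]_(clen (ctype M s))) : label :=
  inr (Tagged (fun s => 'rV['F_2]_(clen (ctype M s))) c).

Definition label_type (i : label) : node_type :=
  match i with inl x => inl (tag x) | inr x => inr (tag x) end.

Definition wt_in (i : label) : nat :=
  if i is inl x then hweight (tagged x) else 0.

Definition wt_out (i : label) : nat :=
  if i is inl x then hweight (tagged x *m vgen (vtype M (tag x))) else 0.

Definition wt_chk (i : label) : nat :=
  if i is inr x then hweight (tagged x) else 0.

Definition codeword_label (i : label) : bool :=
  if i is inr x then tagged x \in ccode (ctype M (tag x)) else true.

(** Positions are plain numbers, with value 0 out of range, so that a label can be read at a node
    before its type is known to fit. *)
Definition coord (i : label) (j : nat) : 'F_2 :=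
  match i with
  | inl x => if insub j is Some j' then tagged x 0 j' else 0
  | inr x => if insub j is Some j' then tagged x 0 j' else 0
  end.

Variable n : nat.

Definition node : finType := (vnode M n + cnode M n)%type.

Definition ntype (a : node) : node_type :=
  match a with inl x => inl (tag x) | inr x => inr (tag x) end.

Definition cpattern : finType := {ffun csocket M n -> 'F_2}.

Definition local_pattern (y : cpattern) (c : cnode M n) :
    'rV['F_2]_(clen (ctype M (tag c))) :=
  \row_j y (Tagged (fun c : cnode M n => 'I_(clen (ctype M (tag c)))) j).

Definition pattern_in_code (y : cpattern) : bool :=
  [forall c, local_pattern y c \in ccode (ctype M (tag c))].

Definition labelling_of (p : word M n * cpattern) : {ffun node -> label} :=
  [ffun a => match a with
    | inl v => vlabel (local_input p.1 v)
    | inr c => clabel (local_pattern p.2 c) end].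

Definition unlabelling (F : {ffun node -> label}) : word M n * cpattern :=
  ([ffun x : inbit M n => coord (F (inl (tag x))) (nat_of_ord (tagged x))],
   [ffun x : csocket M n => coord (F (inr (tag x))) (nat_of_ord (tagged x))]).

Lemma labelling_ofK : cancel labelling_of unlabelling.
Proof.
move=> [w y]; congr pair; apply/ffunP => -[a j]; rewrite !ffunE /=.
  by rewrite (valK j) mxE.
by rewrite (valK j) mxE.
Qed.

Lemma vlabel_coord (x : label) t : label_type x = inl t ->
  x = vlabel (\row_j coord x (j : 'I_(vdim (vtype M t)))).
Proof.
case: x => [[t' m]|//] /= [<-]; congr vlabel.
by apply/rowP => j; rewrite mxE (valK j).
Qed.

Lemma clabel_coord (x : label) t : label_type x = inr t ->
  x = clabel (\row_j coord x (j : 'I_(clen (ctype M t)))).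
Proof.
case: x => [//|[t' m]] /= [<-]; congr clabel.
by apply/rowP => j; rewrite mxE (valK j).
Qed.

(** Identifies the image of [labelling_of], for reindexing sums over pairs as sums over
    labellings. *)
Lemma unlabellingK F :
  (labelling_of (unlabelling F) == F) = [forall a, label_type (F a) == ntype a].
Proof.
apply/eqP/forallP => [<- [v|c]|h]; rewrite ?ffunE//.
apply/ffunP => -[v|c]; rewrite ffunE.
  rewrite [RHS](vlabel_coord (eqP (h (inl v)))); congr vlabel.
  by apply/rowP => j; rewrite !mxE !ffunE.
rewrite [RHS](clabel_coord (eqP (h (inr c)))); congr clabel.
by apply/rowP => j; rewrite !mxE !ffunE.
Qed.

Lemma sum_node (w : label -> nat) (F : {ffun node -> label}) :
  (\sum_a w (F a) = \sum_v w (F (inl v)) + \sum_c w (F (inr c)))%N.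
Proof. by rewrite big_sumType. Qed.

Lemma word_weight_labelling (p : word M n * cpattern) : word_weight p.1 = (\sum_a wt_in (labelling_of p a))%N.
Proof.
rewrite sum_node [X in (_ + X)%N]big1 ?addn0; last by move=> c _; rewrite ffunE.
rewrite /word_weight hweight_tagged; apply: eq_bigr => v _; by rewrite ffunE.
Qed.

Lemma sent_weight_labelling (p : word M n * cpattern) :
  #|[set s | sent p.1 s != 0]%SET| = (\sum_a wt_out (labelling_of p a))%N.
Proof.
rewrite sum_node [X in (_ + X)%N]big1 ?addn0; last by move=> c _; rewrite ffunE.
rewrite hweight_tagged; apply: eq_bigr => v _; rewrite ffunE /=; congr hweight.
by apply/rowP => j; rewrite mxE.
Qed.

Lemma pattern_weight_labelling (p : word M n * cpattern) :
  #|[set s | p.2 s != 0]%SET| = (\sum_a wt_chk (labelling_of p a))%N.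
Proof.
rewrite sum_node [X in (X + _)%N]big1 ?add0n; last by move=> c _; rewrite ffunE.
by rewrite hweight_tagged; apply: eq_bigr => c _; rewrite ffunE.
Qed.

Lemma pattern_in_code_labelling (p : word M n * cpattern) :
  pattern_in_code p.2 = [forall a, codeword_label (labelling_of p a)].
Proof.
apply/forallP/forallP => [h [v|c]|h c]; rewrite ?ffunE//; first exact: h.
by have := h (inr c); rewrite ffunE.
Qed.

End Labellings.

(** A binary pattern is a labelling with two labels, one fiber being the set of ones. The bijections
    exist only if both patterns have equally many ones. *)
Lemma card_bij_patterns (A B : finType) (a : A -> 'F_2) (b : B -> 'F_2) :
  #|A| = #|B| ->
  #|[set h : {ffun A -> B} | injectiveb h && [forall x, b (h x) == a x]]%SET| =
  (if #|[set x | a x != 0%R]%SET| == #|[set x | b x != 0%R]%SET|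
   then (#|[set x | a x != 0%R]%SET|)`! * (#|A| - #|[set x | a x != 0%R]%SET|)`! else 0)%N.
Proof.
move=> cAB; pose fa x := a x != 0; pose fb x := b x != 0.
have tE (T : finType) (f : T -> 'F_2) : fiber (fun x => f x != 0) true = [set x | f x != 0]%SET.
  by apply/setP => x; rewrite !inE eqb_id.
have fE (T : finType) (f : T -> 'F_2) : fiber (fun x => f x != 0) false = (~: [set x | f x != 0])%SET.
  by apply/setP => x; rewrite !inE eqbF_neg.
have cC (T : finType) (S : {set T}) : #|~: S|%SET = (#|T| - #|S|)%N.
  by rewrite cardsCs finset.setCK.
have -> : [set h : {ffun A -> B} | injectiveb h && [forall x, b (h x) == a x]]%SET =
  [set h : {ffun A -> B} | injectiveb h && [forall x, fb (h x) == fa x]]%SET.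
  apply/setP => h; rewrite !inE; congr andb.
  by apply: eq_forallb => x; rewrite F2_eq_neq0.
case: eqP => [e|ne].
  rewrite card_labelled_bij; first by rewrite big_bool/= tE fE cC.
  by case; rewrite ?tE ?fE// !cC e cAB.
apply: eq_card0 => h; rewrite inE; apply/negP => /andP[/injectiveP hI /forallP hb].
apply: ne; rewrite -(card_imset _ hI); apply: eq_card => y; rewrite inE.
have [k hK kK] : bijective h by apply: inj_card_bij => //; rewrite cAB.
apply/imsetP/idP => [[x]|y0].
  by rewrite inE => x0 ->; have /eqP := hb x; rewrite /fb => ->.
exists (k y); rewrite ?kK// inE.
by have /eqP := hb (k y); rewrite kK /fa => <-.
Qed.

(** * The expected number of codewords as a sum over labellings *)

Section Expected.
Context {R : realType} (M : ensemble R) (n : nat).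
Hypothesis sockets : #|vsocket M n| = #|csocket M n|.

Let E := #|vsocket M n|.

Lemma interleaverE : interleaver M n =
  [set f : {ffun vsocket M n -> csocket M n} | injectiveb f]%SET.
Proof.
apply/setP => f; rewrite !inE; apply: andb_idr => /injectiveP fI.
have [k fK kK] : bijective f by apply: inj_card_bij => //; rewrite sockets.
by apply/forallP => s; apply/existsP; exists (k s); rewrite kK.
Qed.

Lemma card_interleaver : #|interleaver M n| = E`!.
Proof.
have fT (A : finType) b : #|fiber (fun _ : A => tt) b| = #|A|.
  by apply: eq_card => x; rewrite inE; case: b.
(* A single label makes every bijection label-preserving. *)
transitivity (\prod_(b : unit) (#|fiber (fun _ : vsocket M n => tt) b|)`!)%N.
  rewrite interleaverE -(@card_labelled_bij _ _ _ _ (fun _ : csocket M n => tt)).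
    by apply: eq_card => f; rewrite !inE andb_idr// => _; exact/forallP.
  by move=> b; rewrite !fT.
by rewrite (big_pred1 tt) ?fT//; case.
Qed.

(** The received pattern is determined by the word and [f]. Keeping it as a second component
    separates the variable side from the check side, with [f] only in the last condition. *)
Lemma num_codewords_pairs (f : {ffun vsocket M n -> csocket M n}) k :
  f \in interleaver M n ->
  num_codewords f k = #|[set p : word M n * cpattern M n |
    [&& word_weight p.1 == k, pattern_in_code p.2 &
      [forall r, p.2 (f r) == sent p.1 r]]]%SET|.
Proof.
rewrite interleaverE inE => /injectiveP fI.
have [g fK gK] : bijective f by apply: inj_card_bij => //; rewrite sockets.
pose y (w : word M n) : cpattern M n := [ffun s => received f w s].
have yE w r : y w (f r) = sent w r.
  rewrite ffunE /received; case: pickP => [r' /eqP/fI ->//|/(_ r)].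
  by rewrite eqxx.
have codeE w : pattern_in_code (y w) = is_codeword f w.
  apply: eq_forallb => c; apply: (f_equal (fun x => x \in ccode (ctype M (tag c)))).
  by apply/rowP => j; rewrite [LHS]mxE [RHS]mxE ffunE.
rewrite /num_codewords -(card_imset (f := fun w => (w, y w))); last by move=> ? ? [].
apply: eq_card => -[w z]; rewrite !inE /=; apply/imsetP/and3P => [[w']|[wk zc /forallP zf]].
  rewrite inE => /andP[wc wk] [-> ->]; split=> //; first by rewrite codeE.
  by apply/forallP => r; rewrite yE.
have zE : z = y w by apply/ffunP => s; rewrite -(gK s) yE (eqP (zf _)).
by exists w; rewrite ?zE// inE wk andbT -codeE -zE.
Qed.

(** Double counting: for a fixed pair of a word and a check pattern, the permutations that match the
    two sides are counted by [card_bij_patterns]. *)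
Lemma sum_num_codewords k :
  (\sum_(f in interleaver M n) num_codewords f k =
  \sum_(F : {ffun node M n -> label M} |
      [&& [forall a, label_type (F a) == ntype a], [forall a, codeword_label (F a)],
          \sum_a wt_in (F a) == k & \sum_a wt_out (F a) == \sum_a wt_chk (F a)])
    (\sum_a wt_out (F a))`! * (E - \sum_a wt_out (F a))`!)%N.
Proof.
rewrite (eq_bigr _ (fun f fi => num_codewords_pairs k fi)).
under eq_bigr do rewrite -sum1dep_card.
rewrite (exchange_big_dep (fun p : word M n * cpattern M n =>
  (word_weight p.1 == k) && pattern_in_code p.2))/=; last first.
  by move=> f p _ /and3P[-> ->].
transitivity (\sum_(p : word M n * cpattern M n |
    [&& word_weight p.1 == k, pattern_in_code p.2 &
     #|[set s | sent p.1 s != 0%R]%SET| == #|[set s | p.2 s != 0%R]%SET|])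
    (#|[set s | sent p.1 s != 0%R]%SET|)`! * (E - #|[set s | sent p.1 s != 0%R]%SET|)`!)%N.
  rewrite [RHS](eq_bigl (fun p => ((word_weight p.1 == k) && pattern_in_code p.2) &&
    (#|[set s | sent p.1 s != 0%R]%SET| == #|[set s | p.2 s != 0%R]%SET|))); last first.
    by move=> p; rewrite andbA.
  rewrite [RHS]big_mkcondr; apply: eq_bigr => p /andP[pw pc].
  rewrite -card_bij_patterns// -sum1dep_card; apply: eq_bigl => f.
  by rewrite interleaverE inE pw pc.
rewrite (reindex_onto (@unlabelling _ M n) (@labelling_of _ M n)); last first.
  by move=> p _; exact: labelling_ofK.
apply: eq_big => [F|F /andP[_ /eqP e]]; last by rewrite sent_weight_labelling e.
rewrite andbC unlabellingK; case: forallP => // h; rewrite !andTb.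
have e : labelling_of (unlabelling F) = F by apply/eqP; rewrite unlabellingK; exact/forallP.
by rewrite word_weight_labelling sent_weight_labelling pattern_weight_labelling
  pattern_in_code_labelling e andbCA.
Qed.

Lemma expected_numE k : expected_num M n k =
  \sum_(F : {ffun node M n -> label M} |
      [&& [forall a, label_type (F a) == ntype a], [forall a, codeword_label (F a)],
          (\sum_a wt_in (F a))%N == k & (\sum_a wt_out (F a))%N == (\sum_a wt_chk (F a))%N])
    ((\sum_a wt_out (F a))%N`!%:R * (E - \sum_a wt_out (F a))%N`!%:R / E`!%:R).
Proof.
rewrite /expected_num -natr_sum sum_num_codewords card_interleaver natr_sum mulr_suml.
by apply: eq_bigr => F _; rewrite natrM.
Qed.

End Expected.

(** * Enumerators as sums over words *)

Lemma hweight0 n : hweight (0 : 'rV['F_2]_n) = 0%N.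
Proof. by apply: eq_card0 => j; rewrite inE mxE eqxx. Qed.

Lemma hweight_gt0 n (c : 'rV['F_2]_n) : (0 < hweight c)%N = (c != 0).
Proof.
apply/idP/idP => [|c0]; first by apply: contraTneq => ->; rewrite hweight0.
have [j cj] : exists j, c 0 j != 0 by apply/rV0Pn.
by apply/card_gt0P; exists j; rewrite inE.
Qed.

Lemma hweight_le n (c : 'rV['F_2]_n) : (hweight c <= n)%N.
Proof. by rewrite -[n in leqRHS]card_ord max_card. Qed.

Lemma hweight_full n (c : 'rV['F_2]_n) : hweight c = n -> c = const_mx 1.
Proof.
move=> e; apply/rowP => j; rewrite mxE; have : j \in [set: 'I_n]%SET by rewrite inE.
have <- : [set j | c 0 j != 0]%SET = [set: 'I_n]%SET.
  by apply/eqP; rewrite eqEcard finset.subsetT cardsT card_ord -/(hweight c) e leqnn.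
by rewrite inE; case: (c 0 j) => -[|[|//]] // h _; apply/val_inj.
Qed.

Lemma min_distance_gt0 n (C : {pred 'rV['F_2]_n}) : (0 < n)%N -> (0 < min_distance C)%N.
Proof.
move=> n0; apply: (big_ind (fun k => (0 < k)%N)) => // [a b|c /andP[_]]; last by rewrite hweight_gt0.
by rewrite leq_min => -> ->.
Qed.

Lemma min_distance_le n (C : {pred 'rV['F_2]_n}) c :
  c \in C -> c != 0 -> (min_distance C <= hweight c)%N.
Proof.
move=> cC c0; rewrite /min_distance -big_filter.
have : c \in [seq c <- index_enum _ | (c \in C) && (c != 0)].
  by rewrite mem_filter cC c0 mem_index_enum.
elim: [seq _ <- _ | _] => // a s IH; rewrite inE big_cons => /predU1P[->|/IH h].
  exact: geq_minl.
exact: leq_trans (geq_minr _ _) h.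
Qed.

Section WeightSums.
Context {R : realType} {J : finType}.

Lemma sum_by_weight (P : pred J) (h : J -> nat) (lo hi : nat) (F : J -> R) :
  (forall j, P j -> (lo <= h j < hi)%N) ->
  \sum_(lo <= u < hi) \sum_(j | P j && (h j == u)) F j = \sum_(j | P j) F j.
Proof.
move=> hr; rewrite (exchange_big_dep P)/=; last by move=> u j _ /andP[].
apply: eq_bigr => j Pj; rewrite big_mkcond/= (bigD1_seq (h j))/= ?iota_uniq//; last first.
  by rewrite mem_index_iota hr.
by rewrite Pj eqxx/= big1 ?addr0// => u ne; rewrite eq_sym (negbTE ne).
Qed.

(** Multiplication by [x] restores the exponent lowered by the derivative, so the logarithmic
    derivatives in the system are mean weights. *)
Lemma mul_derive1_sum (P : pred J) (a : J -> R) (h : J -> nat) (x : R) :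
  x * derive1 (fun s => \sum_(j | P j) a j * s ^+ h j) x =
  \sum_(j | P j) (h j)%:R * (a j * x ^+ h j).
Proof.
pose p : {poly R} := \sum_(j | P j) a j *: 'X^(h j).
have -> : (fun s => \sum_(j | P j) a j * s ^+ h j) = horner p.
  by apply/funext => s; rewrite horner_sum; apply: eq_bigr => j _; rewrite !hornerE.
rewrite -derivE raddf_sum horner_sum mulr_sumr; apply: eq_bigr => j _ /=.
rewrite derivZ derivXn hornerZ hornerMn hornerXn.
case: (h j) => [|k]; first by rewrite mulr0n mulr0 mul0r mulr0.
by rewrite -mulr_natr exprS /=; ring.
Qed.

End WeightSums.

Section Enumerators.
Context {R : realType}.

(** The leading 1 is the zero word, and no other codeword has weight below the minimum distance. *)
Lemma AenumE (T : check_type) (z : R) :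
  Aenum T z = \sum_(c in ccode T) z ^+ hweight c.
Proof.
rewrite (bigD1 0) ?mem0v//= hweight0 expr0; congr (1 + _).
have d0 : (0 < cdist T)%N by apply: min_distance_gt0; exact: clen_gt0.
rewrite -(@sum_by_weight _ _ _ (@hweight (clen T)) (cdist T) (clen T).+1); last first.
  by move=> c /andP[cC c0]; rewrite ltnS hweight_le andbT min_distance_le.
apply: eq_big_nat => u /andP[du _]; rewrite /ccoef -sum1dep_card natr_sum mulr_suml.
apply: eq_big => [c|c /andP[_ /eqP ->]]; last by rewrite mul1r.
(* The zero word is not counted in [ccoef T u], as [u] is at least the positive minimum distance. *)
have [->|//] := eqVneq c 0; last by rewrite andbT.
by rewrite hweight0 andbF/=; apply/negbTE/negP => /andP[_ /eqP u0]; rewrite -u0 leqNgt d0 in du.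
Qed.

Lemma vgen_neq0 (T : var_type) (m : 'rV['F_2]_(vdim T)) :
  m != 0 -> m *m vgen T != 0.
Proof.
by apply: contraNneq => e; apply/eqP/(row_free_inj (vgen_free T)); rewrite e mul0mx.
Qed.

(** The leading 1 is the zero input; other inputs have positive weight and, the encoding being
    injective, a codeword of weight at least the minimum distance. *)
Lemma BenumE (T : var_type) (x y : R) :
  Benum T x y = \sum_m x ^+ hweight m * y ^+ hweight (m *m vgen T).
Proof.
rewrite (bigD1 0)//= mul0mx !hweight0 !expr0 mul1r; congr (1 + _).
rewrite -(@sum_by_weight _ _ _ (@hweight (vdim T)) 1 (vdim T).+1); last first.
  by move=> m m0; rewrite ltnS hweight_le hweight_gt0 m0.
apply: eq_big_nat => u /andP[u0 _].
rewrite -(@sum_by_weight _ _ _ (fun m => hweight (m *m vgen T)) (vdist T) (vlen T).+1); last first.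
  move=> m /andP[m0 _]; rewrite ltnS hweight_le andbT min_distance_le ?vgen_neq0//.
  by rewrite inE; exact: submxMl.
apply: eq_big_nat => v _; rewrite /vcoef -sum1dep_card natr_sum !mulr_suml.
apply: eq_big => [m|m /andP[/eqP -> /eqP ->]]; last by rewrite mul1r.
by have [->|//] := eqVneq m 0; rewrite hweight0 eq_sym gtn_eqF.
Qed.

Lemma mul_Aenum_z (T : check_type) (z : R) :
  z * Aenum_z T z = \sum_(c in ccode T) (hweight c)%:R * z ^+ hweight c.
Proof.
rewrite /Aenum_z (_ : (fun s => _) = fun s => \sum_(c in ccode T) 1 * s ^+ hweight c).
  by rewrite mul_derive1_sum; apply: eq_bigr => c _; rewrite mul1r.
by apply/funext => s; rewrite AenumE; apply: eq_bigr => c _; rewrite mul1r.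
Qed.

Lemma mul_Benum_x (T : var_type) (x y : R) :
  x * Benum_x T x y =
  \sum_m (hweight m)%:R * (x ^+ hweight m * y ^+ hweight (m *m vgen T)).
Proof.
rewrite /Benum_x (_ : (fun s => _) =
    fun s => \sum_m y ^+ hweight (m *m vgen T) * s ^+ hweight m).
  by rewrite mul_derive1_sum; apply: eq_bigr => m _; congr (_ * _); rewrite mulrC.
by apply/funext => s; rewrite BenumE; apply: eq_bigr => m _; rewrite mulrC.
Qed.

Lemma mul_Benum_y (T : var_type) (x y : R) :
  y * Benum_y T x y =
  \sum_m (hweight (m *m vgen T))%:R * (x ^+ hweight m * y ^+ hweight (m *m vgen T)).
Proof.
rewrite /Benum_y (_ : (fun s => _) =
    fun s => \sum_m x ^+ hweight m * s ^+ hweight (m *m vgen T)).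
  by rewrite mul_derive1_sum.
by apply/funext => s; rewrite BenumE.
Qed.

Lemma Aenum_gt0 (T : check_type) (z : R) : 0 < z -> 0 < Aenum T z.
Proof.
move=> z0; rewrite AenumE (bigD1 0) ?mem0v//= hweight0 ltr_pwDl// sumr_ge0// => c _.
by rewrite exprn_ge0// ltW.
Qed.

Lemma Benum_gt0 (T : var_type) (x y : R) : 0 < x -> 0 < y -> 0 < Benum T x y.
Proof.
move=> x0 y0; rewrite BenumE (bigD1 0)//= mul0mx !hweight0 mulr1 ltr_pwDl// sumr_ge0// => m _.
by rewrite mulr_ge0// exprn_ge0// ltW.
Qed.

Lemma int_rho_gt0 (M : ensemble R) : 0 < int_rho M.
Proof.
rewrite int_rhoE lt_neqAle sumr_ge0 ?andbT; last first.
  by move=> t _; rewrite divr_ge0// rho_ge0.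
apply/negP => /eqP /esym/eqP; rewrite psumr_eq0; last first.
  by move=> t _; rewrite divr_ge0// rho_ge0.
move=> /allP h; have := sum_rho M; rewrite big1 => [/esym/eqP|t _]; first by rewrite oner_eq0.
have := h t; rewrite mem_index_enum => /(_ isT) /=.
by rewrite mulf_eq0 invr_eq0 pnatr_eq0 gtn_eqF ?clen_gt0// orbF => /eqP.
Qed.

Lemma int_lambda_gt0 (M : ensemble R) : 0 < int_lambda M.
Proof.
rewrite int_lambdaE lt_neqAle sumr_ge0 ?andbT; last first.
  by move=> t _; rewrite divr_ge0// lambda_ge0.
apply/negP => /eqP /esym/eqP; rewrite psumr_eq0; last first.
  by move=> t _; rewrite divr_ge0// lambda_ge0.
move=> /allP h; have := sum_lambda M; rewrite big1 => [/esym/eqP|t _]; first by rewrite oner_eq0.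
have := h t; rewrite mem_index_enum => /(_ isT) /=.
by rewrite mulf_eq0 invr_eq0 pnatr_eq0 gtn_eqF ?vlen_gt0// orbF => /eqP.
Qed.

End Enumerators.

(** * The polytope of joint types *)

Section Polytope.
Context {R : realType} (M : ensemble R).
Let iL := int_lambda M.
Let iR := int_rho M.
Let iL0 : 0 < iL. Proof. exact: int_lambda_gt0. Qed.
Let iR0 : 0 < iR. Proof. exact: int_rho_gt0. Qed.

(* Nodes of each type, per variable node. *)
Definition density (t : node_type M) : R :=
  match t with inl t => delta t | inr s => iR / iL * gamma s end.

(** The common support of the points of the exponential family. *)
Definition active (i : label M) : bool :=
  (0 < density (label_type i)) && codeword_label i.

Definition constraint_index : finType := (node_type M + bool + label M)%type.

(* The last family forces the mass of inactive labels to be [0]. *)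
Definition constraint (k : constraint_index) (i : label M) : int :=
  match k with
  | inl (inl t) => (label_type i == t)%:Z
  | inl (inr true) => (wt_in i)%:Z
  | inl (inr false) => (wt_out i)%:Z - (wt_chk i)%:Z
  | inr j => ((i == j) && ~~ active j)%:Z
  end.

(** With [D] and [a] free, the same constraints describe the polytope, its multiple by [n] and, for
    zero values, the kernel. *)
Definition rhs (D : node_type M -> R) (a : R) (k : constraint_index) : R :=
  match k with
  | inl (inl t) => D t
  | inl (inr true) => a
  | _ => 0
  end.

Lemma constraintP D a (X : label M -> R) :
  (forall k, \sum_i (constraint k i)%:~R * X i = rhs D a k) <->
  [/\ forall t, \sum_(i | label_type i == t) X i = D t,
      mean (@wt_in _ M) X = a,
      mean (@wt_out _ M) X = mean (@wt_chk _ M) X &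
      forall i, ~~ active i -> X i = 0].
Proof.
have e1 t : \sum_i (constraint (inl (inl t)) i)%:~R * X i = \sum_(i | label_type i == t) X i.
  rewrite [RHS]big_mkcond; apply: eq_bigr => i _ /=.
  by case: eqP => _; rewrite ?mul1r ?mul0r.
have e2 : \sum_i (constraint (inl (inr false)) i)%:~R * X i =
    mean (@wt_out _ M) X - mean (@wt_chk _ M) X.
  by rewrite -sumrB; apply: eq_bigr => i _; rewrite /= intrB mulrBl.
have e3 j : \sum_i (constraint (inr j) i)%:~R * X i = (~~ active j)%:R * X j.
  rewrite (bigD1 j)//= eqxx /= big1 ?addr0; first by case: (active j).
  by move=> i ij; rewrite (negbTE ij)/= mul0r.
split=> [h|[h1 h2 h3 h4]].
- split=> [t||| i ni].
  + by rewrite -e1 h.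
  + exact: h (inl (inr true)).
  + by apply/eqP; rewrite -subr_eq0 -e2 h.
  + by have := h (inr i); rewrite e3 ni mul1r.
- case=> [[t|[]]|j].
  + by rewrite e1 h1.
  + exact: h2.
  + by rewrite e2 h3 subrr.
  + rewrite e3; case: (boolP (active j)) => [_|/h4 ->]; last by rewrite mulr0.
    by rewrite mul0r.
Qed.

Lemma sum_label (V : nmodType) (f : label M -> V) :
  \sum_i f i = \sum_t \sum_m f (vlabel (t := t) m) + \sum_s \sum_c f (clabel (s := s) c).
Proof.
rewrite big_sumType/=; congr (_ + _).
  by rewrite sig_big_dep; apply: eq_bigr => -[].
by rewrite sig_big_dep; apply: eq_bigr => -[].
Qed.

Lemma block_vsum (X : label M -> R) t :
  \sum_(i | label_type i == inl t) X i = \sum_m X (vlabel (t := t) m).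
Proof.
rewrite big_mkcond sum_label/= [X in _ + X]big1 ?addr0; last by move=> s _; rewrite big1.
rewrite (bigD1 t)//= [X in _ + X]big1 ?addr0 ?eqxx// => t' ne.
by rewrite big1// => m _; rewrite -[inl t' == _]/(t' == t) (negbTE ne).
Qed.

Lemma block_csum (X : label M -> R) s :
  \sum_(i | label_type i == inr s) X i = \sum_c X (clabel (s := s) c).
Proof.
rewrite big_mkcond sum_label/= [X in X + _]big1 ?add0r; last by move=> t _; rewrite big1.
rewrite (bigD1 s)//= [X in _ + X]big1 ?addr0 ?eqxx// => s' ne.
by rewrite big1// => c _; rewrite -[inr s' == _]/(s' == s) (negbTE ne).
Qed.

Lemma mean_in (X : label M -> R) :
  mean (@wt_in _ M) X = \sum_t \sum_m (hweight m)%:R * X (vlabel (t := t) m).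
Proof.
rewrite /mean sum_label/= [X in _ + X]big1 ?addr0// => s _.
by rewrite big1// => c _; rewrite mul0r.
Qed.

Lemma mean_out (X : label M -> R) :
  mean (@wt_out _ M) X =
  \sum_t \sum_m (hweight (m *m vgen (vtype M t)))%:R * X (vlabel (t := t) m).
Proof.
rewrite /mean sum_label/= [X in _ + X]big1 ?addr0// => s _.
by rewrite big1// => c _; rewrite mul0r.
Qed.

Lemma mean_chk (X : label M -> R) :
  mean (@wt_chk _ M) X = \sum_s \sum_c (hweight c)%:R * X (clabel (s := s) c).
Proof.
rewrite /mean sum_label/= [X in X + _]big1 ?add0r// => t _.
by rewrite big1// => m _; rewrite mul0r.
Qed.

Lemma delta_ge0 (t : 'I_(nv M)) : 0 <= delta t.
Proof. by rewrite divr_ge0 ?lambda_ge0// mulr_ge0// ltW. Qed.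

Lemma gamma_ge0 (s : 'I_(nc M)) : 0 <= gamma s.
Proof. by rewrite divr_ge0 ?rho_ge0// mulr_ge0// ltW. Qed.

Lemma density_ge0 t : 0 <= density t.
Proof. by case: t => t /=; rewrite ?delta_ge0// mulr_ge0 ?gamma_ge0// divr_ge0// ltW. Qed.

(** The number of edges per variable node, counted at the variable nodes; the count at the check
    nodes, which comes next, agrees. *)
Lemma sum_vlen_density : \sum_t (vlen (vtype M t))%:R * delta t = iL^-1.
Proof.
rewrite -[RHS]mul1r -[in RHS](sum_lambda M) mulr_suml; apply: eq_bigr => t _.
rewrite /delta -/iL; field.
by rewrite gt_eqF//= pnatr_eq0 gtn_eqF// vlen_gt0.
Qed.

Lemma sum_clen_density : \sum_s (clen (ctype M s))%:R * (iR / iL * gamma s) = iL^-1.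
Proof.
rewrite -[RHS]mul1r -[in RHS](sum_rho M) mulr_suml; apply: eq_bigr => s _.
rewrite /gamma -/iR; field.
by rewrite !gt_eqF ?ltr0n ?clen_gt0.
Qed.

Section Feasible.
Context (alpha : R) (alpha_gt0 : 0 < alpha).

Definition in_polytope := feasible constraint (rhs density alpha).

Context (X : label M -> R) (fX : in_polytope X).

Lemma polytope_block t : \sum_(i | label_type i == t) X i = density t.
Proof. by have /constraintP[h _ _ _] := fX.2. Qed.

Lemma polytope_vblock t : \sum_m X (vlabel (t := t) m) = delta t.
Proof. by rewrite -block_vsum polytope_block. Qed.

Lemma polytope_cblock s : \sum_c X (clabel (s := s) c) = iR / iL * gamma s.
Proof. by rewrite -block_csum polytope_block. Qed.

Lemma polytope_in : mean (@wt_in _ M) X = alpha.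
Proof. by have /constraintP[_ h _ _] := fX.2. Qed.

Lemma polytope_chk : mean (@wt_chk _ M) X = mean (@wt_out _ M) X.
Proof. by have /constraintP[_ _ h _] := fX.2. Qed.

Lemma polytope_inactive i : ~~ active i -> X i = 0.
Proof. by have /constraintP[_ _ _ h] := fX.2; exact: h. Qed.

Lemma polytope_le i : X i <= \sum_t density t.
Proof.
apply: (@le_trans _ _ (density (label_type i))); last first.
  by rewrite (bigD1 (label_type i))//= lerDl sumr_ge0// => t _; exact: density_ge0.
rewrite -polytope_block (bigD1 i)//= lerDl sumr_ge0// => j _; exact: fX.1.
Qed.

(** The density of edges carrying a zero as a sum of nonnegative terms; it bounds the density of
    ones and shows what equality forces. *)
Lemma sum_gap_out : \sum_t \sum_m
    ((vlen (vtype M t))%:R - (hweight (m *m vgen (vtype M t)))%:R) * X (vlabel (t := t) m) =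
  iL^-1 - mean (@wt_out _ M) X.
Proof.
rewrite -sum_vlen_density mean_out -sumrB; apply: eq_bigr => t _.
rewrite -polytope_vblock mulr_sumr -sumrB; apply: eq_bigr => m _; exact: mulrBl.
Qed.

Lemma sum_gap_chk : \sum_s \sum_c
    ((clen (ctype M s))%:R - (hweight c)%:R) * X (clabel (s := s) c) =
  iL^-1 - mean (@wt_chk _ M) X.
Proof.
rewrite -sum_clen_density mean_chk -sumrB; apply: eq_bigr => s _.
rewrite -polytope_cblock mulr_sumr -sumrB; apply: eq_bigr => c _; exact: mulrBl.
Qed.

Lemma polytope_out_le : mean (@wt_out _ M) X <= iL^-1.
Proof.
rewrite -subr_ge0 -sum_gap_out; apply: sumr_ge0 => t _; apply: sumr_ge0 => m _.
by rewrite mulr_ge0 ?fX.1// subr_ge0 ler_nat hweight_le.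
Qed.

(** If no ones are sent, all mass is on inputs encoded to zero; by injectivity these are zero, which
    contradicts [0 < alpha]. *)
Lemma polytope_out_gt0 : 0 < mean (@wt_out _ M) X.
Proof.
have t0 t m : 0 <= (hweight (m *m vgen (vtype M t)))%:R * X (vlabel (t := t) m).
  by rewrite mulr_ge0 ?fX.1.
rewrite lt_neqAle mean_out sumr_ge0 ?andbT; last first.
  by move=> t _; apply: sumr_ge0.
apply/negP => /eqP /esym/eqP; rewrite psumr_eq0; last by move=> t _; apply: sumr_ge0.
move=> /allP h; have := polytope_in; rewrite mean_in big1.
  by move=> e; move: alpha_gt0; rewrite -e ltxx.
move=> t _; have := h t; rewrite mem_index_enum => /(_ isT) /=.
rewrite psumr_eq0// => /allP h'; rewrite big1// => m _.
have := h' m; rewrite mem_index_enum => /(_ isT) /=; rewrite mulf_eq0 => /orP[|/eqP ->].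
  rewrite pnatr_eq0 -leqn0 leqNgt hweight_gt0 negbK => /eqP e.
  have [->|/vgen_neq0] := eqVneq m 0; first by rewrite hweight0 mul0r.
  by rewrite e eqxx.
by rewrite mulr0.
Qed.

End Feasible.
End Polytope.

(** * Types with a one on every edge *)

Lemma psumr_eq0_term (R : realType) (J : finType) (F : J -> R) :
  (forall j, 0 <= F j) -> \sum_j F j = 0 -> forall j, F j = 0.
Proof.
move=> F0 /eqP; rewrite psumr_eq0// => /allP h j.
by have := h j; rewrite mem_index_enum => /(_ isT) /eqP.
Qed.

Lemma sum_concentrated (R : realType) (J : finType) (F : J -> R) (j0 : J) (s : R) :
  (forall j, 0 <= F j) -> \sum_j F j = s -> (0 < s -> forall j, F j = 0 \/ j = j0) ->
  forall j, F j = if j == j0 then s else 0.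
Proof.
move=> F0 hs hc j.
have [s0|s0] := ltP 0 s.
  have z k : k != j0 -> F k = 0 by case: (hc s0 k) => // ->; rewrite eqxx.
  case: ifPn => [/eqP ->|/z//].
  by rewrite -hs (bigD1 j0)//= big1 ?addr0// => k /z.
have e : s = 0 by apply/eqP; rewrite eq_le s0 -hs sumr_ge0.
by rewrite (psumr_eq0_term F0 _ j) ?hs// e if_same.
Qed.

Section Boundary.
Context {R : realType} (M : ensemble R) (alpha : R).
Let iL := int_lambda M.
Let iR := int_rho M.
Let iL0 : 0 < iL. Proof. exact: int_lambda_gt0. Qed.
Let iR0 : 0 < iR. Proof. exact: int_rho_gt0. Qed.

Lemma delta_gt0 (t : 'I_(nv M)) : (0 < delta t) = (0 < lambda M t).
Proof. by rewrite /delta pmulr_lgt0// invr_gt0 mulr_gt0// ltr0n vlen_gt0. Qed.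

Lemma cdensity_gt0 (s : 'I_(nc M)) : (0 < density (inr s : node_type M)) = (0 < rho M s).
Proof.
rewrite /= (pmulr_rgt0 _ (divr_gt0 iR0 iL0)) /gamma pmulr_lgt0// invr_gt0 mulr_gt0//.
by rewrite ltr0n clen_gt0.
Qed.

(** All gaps vanish, so only labels with all-one local codeword carry mass, and injective encoding
    leaves at most one per type. Hence [X] repeats the node densities, and all [eta] terms
    cancel. *)
Lemma polytope_boundary (X : label M -> R) : in_polytope alpha X ->
  mean (@wt_out _ M) X = iL^-1 ->
  all_one_codeword M alpha /\
  growth_exponent (@wt_out _ M) (@density _ M) iL^-1 X = 0.
Proof.
move=> fX hb.
have vone t m : X (vlabel (t := t) m) = 0 \/ m *m vgen (vtype M t) = const_mx 1.
  have := sum_gap_out fX; rewrite hb subrr => h.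
  have h1 := psumr_eq0_term _ h t.
  have ge0 t' m' : 0 <= ((vlen (vtype M t'))%:R -
      (hweight (m' *m vgen (vtype M t')))%:R) * X (vlabel (t := t') m').
    by rewrite mulr_ge0 ?fX.1// subr_ge0 ler_nat hweight_le.
  have {}h1 := psumr_eq0_term (ge0 t) (h1 (fun t' => sumr_ge0 _ (fun m' _ => ge0 t' m'))) m.
  move/eqP: h1; rewrite mulf_eq0 subr_eq0 eqr_nat => /orP[/eqP e|/eqP ->]; last by left.
  by right; apply: hweight_full.
have cone s c : X (clabel (s := s) c) = 0 \/ c = const_mx 1.
  have := sum_gap_chk fX; rewrite (polytope_chk fX) hb subrr => h.
  have h1 := psumr_eq0_term _ h s.
  have ge0 s' c' : 0 <= ((clen (ctype M s'))%:R - (hweight c')%:R) * X (clabel (s := s') c').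
    by rewrite mulr_ge0 ?fX.1// subr_ge0 ler_nat hweight_le.
  have {}h1 := psumr_eq0_term (ge0 s) (h1 (fun s' => sumr_ge0 _ (fun c' _ => ge0 s' c'))) c.
  move/eqP: h1; rewrite mulf_eq0 subr_eq0 eqr_nat => /orP[/eqP e|/eqP ->]; last by left.
  by right; apply: hweight_full.
(* The default 0 is taken only where the all-one word is not encoded; then all labels of type [t]
   have mass 0, and so [delta t = 0]. *)
pose mt t : 'rV['F_2]_(vdim (vtype M t)) :=
  odflt 0 [pick m : 'rV['F_2]_(vdim (vtype M t)) | m *m vgen (vtype M t) == const_mx 1].
have mtE t m : m *m vgen (vtype M t) = const_mx 1 -> m = mt t.
  rewrite /mt => e; case: pickP => [m' /eqP e'|/(_ m)]; last by rewrite e eqxx.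
  by apply: (row_free_inj (vgen_free (vtype M t))); rewrite e e'.
have vX t m : X (vlabel (t := t) m) = if m == mt t then delta t else 0.
  apply: (sum_concentrated (F := fun m => X (vlabel m))) => [m'||_ m'].
  - exact: fX.1.
  - exact: polytope_vblock fX t.
  - by case: (vone t m') => [->|/mtE]; [left|right].
have cX s c : X (clabel (s := s) c) = if c == const_mx 1 then iR / iL * gamma s else 0.
  apply: (sum_concentrated (F := fun c => X (clabel c))) => [c'||_ c'].
  - exact: fX.1.
  - exact: polytope_cblock fX s.
  - exact: cone.
split; last first.
  rewrite /growth_exponent /entropy hb subrr eta0.
  suff -> : \sum_i eta (X i) = \sum_(t : node_type M) eta (density t) by ring.
  rewrite sum_label [RHS]big_sumType/=; congr (_ + _).
    apply: eq_bigr => t _; rewrite (bigD1 (mt t))//= vX eqxx big1 ?addr0// => m ne.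
    by rewrite vX (negbTE ne) eta0.
  apply: eq_bigr => s _; rewrite (bigD1 (const_mx 1))//= cX eqxx big1 ?addr0// => c ne.
  by rewrite cX (negbTE ne) eta0.
split=> [s s0|].
  apply: contraT => h; have := cX s (const_mx 1); rewrite eqxx.
  have na : ~~ active (clabel (const_mx 1 : 'rV_(clen (ctype M s)))).
    by rewrite /active negb_and h orbT.
  rewrite (polytope_inactive fX na) => e.
  by move: s0; rewrite -cdensity_gt0 /= -/iR -/iL -e ltxx.
exists mt => [t t0|].
  have := vX t (mt t); rewrite eqxx => e; case: (vone t (mt t)) => // e'.
  by move: t0; rewrite -delta_gt0 -e e' ltxx.
rewrite -[RHS](polytope_in fX) mean_in; apply: eq_bigr => t _.
rewrite (bigD1 (mt t))//= vX eqxx big1 ?addr0; first by rewrite mulrC.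
by move=> m ne; rewrite vX (negbTE ne) mulr0.
Qed.

End Boundary.

(** * The exponential family *)

Section ExponentialPoint.
Context {R : realType} (M : ensemble R).
Let iL := int_lambda M.
Let iR := int_rho M.
Let iL0 : 0 < iL. Proof. exact: int_lambda_gt0. Qed.
Let iR0 : 0 < iR. Proof. exact: int_rho_gt0. Qed.

(** A Gibbs distribution within each node type, with [Benum] and [Aenum] as partition functions. *)
Definition exp_point (x y z : R) (i : label M) : R :=
  density (label_type i) *
  match i with
  | inl u => x ^+ hweight (tagged u) * y ^+ hweight (tagged u *m vgen (vtype M (tag u))) /
             Benum (vtype M (tag u)) x y
  | inr u => if tagged u \in ccode (ctype M (tag u))
             then z ^+ hweight (tagged u) / Aenum (ctype M (tag u)) z else 0
  end.

Context (x y z : R) (x0 : 0 < x) (y0 : 0 < y) (z0 : 0 < z).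

Lemma exp_point_gt0 i : active i -> 0 < exp_point x y z i.
Proof.
move=> /andP[d0]; rewrite /exp_point; case: i d0 => [[t m]|[s c]] /= d0 h.
  by rewrite mulr_gt0// divr_gt0 ?Benum_gt0// mulr_gt0// exprn_gt0.
by rewrite h mulr_gt0// divr_gt0 ?Aenum_gt0// exprn_gt0.
Qed.

Lemma exp_point_inactive i : ~~ active i -> exp_point x y z i = 0.
Proof.
rewrite /active negb_and -leNgt => /orP[d0|]; rewrite /exp_point.
  have -> : density (label_type i) = 0.
    by apply/eqP; rewrite eq_le d0 density_ge0.
  by rewrite mul0r.
by case: i => [[t m]|[s c]] //= /negbTE ->; rewrite mulr0.
Qed.

Lemma exp_point_ge0 i : 0 <= exp_point x y z i.
Proof.
by have [/exp_point_gt0/ltW//|/exp_point_inactive->] := boolP (active i).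
Qed.

Lemma sum_exp_point_v t (w : 'rV['F_2]_(vdim (vtype M t)) -> R) :
  \sum_m w m * exp_point x y z (vlabel (t := t) m) =
  delta t * ((\sum_m w m * (x ^+ hweight m * y ^+ hweight (m *m vgen (vtype M t)))) /
    Benum (vtype M t) x y).
Proof.
by rewrite mulr_suml mulr_sumr; apply: eq_bigr => m _; rewrite /exp_point /= mulrCA !mulrA.
Qed.

Lemma sum_exp_point_c s (w : 'rV['F_2]_(clen (ctype M s)) -> R) :
  \sum_c w c * exp_point x y z (clabel (s := s) c) =
  iR / iL * gamma s * ((\sum_(c in ccode (ctype M s)) w c * z ^+ hweight c) /
    Aenum (ctype M s) z).
Proof.
rewrite [in RHS]big_mkcond mulr_suml mulr_sumr; apply: eq_bigr => c _.
rewrite /exp_point /= -/iR -/iL mulrCA; congr (_ * _).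
by case: ifP => _; rewrite ?mulr0 ?mul0r// mulrA.
Qed.

Lemma exp_point_vblock t : \sum_m exp_point x y z (vlabel (t := t) m) = delta t.
Proof.
under eq_bigr do rewrite -[exp_point _ _ _ _]mul1r.
rewrite sum_exp_point_v; under eq_bigr do rewrite mul1r.
by rewrite -BenumE divff ?mulr1// gt_eqF// Benum_gt0.
Qed.

Lemma exp_point_cblock s :
  \sum_c exp_point x y z (clabel (s := s) c) = iR / iL * gamma s.
Proof.
under eq_bigr do rewrite -[exp_point _ _ _ _]mul1r.
rewrite sum_exp_point_c; under eq_bigr do rewrite mul1r.
by rewrite -AenumE divff ?mulr1// gt_eqF// Aenum_gt0.
Qed.

Lemma exp_point_block t :
  \sum_(i | label_type i == t) exp_point x y z i = density t.
Proof.
by case: t => t; [rewrite block_vsum exp_point_vblock|rewrite block_csum exp_point_cblock].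
Qed.

Lemma exp_point_in : mean (@wt_in _ M) (exp_point x y z) =
  x * \sum_t delta t * (Benum_x (vtype M t) x y / Benum (vtype M t) x y).
Proof.
rewrite mean_in mulr_sumr; apply: eq_bigr => t _.
by rewrite sum_exp_point_v -mul_Benum_x;
  move: (delta t) (Benum_x _ _ _) (Benum _ _ _) => d p q; ring.
Qed.

Lemma exp_point_out : mean (@wt_out _ M) (exp_point x y z) =
  y * \sum_t delta t * (Benum_y (vtype M t) x y / Benum (vtype M t) x y).
Proof.
rewrite mean_out mulr_sumr; apply: eq_bigr => t _.
by rewrite sum_exp_point_v -mul_Benum_y;
  move: (delta t) (Benum_y _ _ _) (Benum _ _ _) => d p q; ring.
Qed.

Lemma exp_point_chk : mean (@wt_chk _ M) (exp_point x y z) =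
  z * (iR / iL) * \sum_s gamma s * (Aenum_z (ctype M s) z / Aenum (ctype M s) z).
Proof.
rewrite mean_chk mulr_sumr; apply: eq_bigr => s _.
by rewrite sum_exp_point_c -mul_Aenum_z; move: (gamma s) (Aenum_z _ _) (Aenum _ _) => g p q; ring.
Qed.

(** The first three equations of the system prescribe the mean weights of the exponential point. *)
Lemma solution_exp_point alpha b : is_positive_solution M alpha x y z b <->
  [/\ 0 < b, mean (@wt_in _ M) (exp_point x y z) = alpha,
      mean (@wt_out _ M) (exp_point x y z) = b,
      mean (@wt_chk _ M) (exp_point x y z) = b &
      b * iL * (1 + y * z) = y * z].
Proof.
rewrite exp_point_in exp_point_out exp_point_chk.
by split=> [[[_ _ _ b0] [h1 h2 h3 h4]]|[b0 h1 h2 h3 h4]].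
Qed.

Section Solution.
Context (alpha b : R) (sol : is_positive_solution M alpha x y z b).

Lemma exp_point_in_polytope : in_polytope alpha (exp_point x y z).
Proof.
have /solution_exp_point[_ h1 h2 h3 _] := sol.
split; first exact: exp_point_ge0.
apply/constraintP; split=> //; first exact: exp_point_block.
- by rewrite h2 h3.
- exact: exp_point_inactive.
Qed.

Lemma solution_beta_lt : b < iL^-1.
Proof.
have /solution_exp_point[_ _ _ _ h] := sol.
have yz : 0 < y * z by rewrite mulr_gt0.
rewrite -(@ltr_pM2r _ iL)// mulVf ?gt_eqF//.
rewrite -(@ltr_pM2r _ (1 + y * z)) ?addr_gt0// h mul1r; lra.
Qed.

(** The last equation says that [y * z] is [b / (iL^-1 - b)], the odds of a one on an edge. *)
Lemma solution_ln_yz : ln y + ln z = ln b - ln (iL^-1 - b).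
Proof.
have /solution_exp_point[b0 _ _ _ h] := sol.
have Lb : 0 < iL^-1 - b by rewrite subr_gt0 solution_beta_lt.
rewrite -lnM ?posrE// -ln_div ?posrE//; congr ln.
apply: (mulIf (lt0r_neq0 Lb)); rewrite divfK ?gt_eqF//.
apply: (mulIf (lt0r_neq0 iL0)).
have -> : y * z * (iL^-1 - b) * iL = y * z - b * iL * (y * z).
  by field; rewrite gt_eqF.
by rewrite -{1}h; ring.
Qed.

(** The logarithm of a Gibbs weight is affine in the two weights, so the entropy of a block reduces
    to its mean weights. *)
Lemma sum_eta_vblock t :
  \sum_m eta (exp_point x y z (vlabel (t := t) m)) =
  eta (delta t) + delta t * ln (Benum (vtype M t) x y)
  - ln x * \sum_m (hweight m)%:R * exp_point x y z (vlabel (t := t) m)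
  - ln y * \sum_m (hweight (m *m vgen (vtype M t)))%:R * exp_point x y z (vlabel (t := t) m).
Proof.
have B0 := Benum_gt0 (vtype M t) x0 y0.
transitivity (\sum_m (exp_point x y z (vlabel (t := t) m) * (ln (Benum (vtype M t) x y) - ln (delta t))
   - ln x * ((hweight m)%:R * exp_point x y z (vlabel (t := t) m))
   - ln y * ((hweight (m *m vgen (vtype M t)))%:R * exp_point x y z (vlabel (t := t) m)))); last first.
  by rewrite !sumrB -!mulr_sumr -mulr_suml exp_point_vblock /eta; ring.
apply: eq_bigr => m _.
have [d0|d0] := ltP 0 (delta t); last first.
  have -> : exp_point x y z (vlabel (t := t) m) = 0.
    by apply: exp_point_inactive; rewrite negb_and -leNgt /= d0.
  by rewrite eta0; ring.
rewrite {1}/eta {2}/exp_point /= lnM ?posrE// ?divr_gt0 ?mulr_gt0 ?exprn_gt0//.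
rewrite ln_div ?posrE ?mulr_gt0 ?exprn_gt0// lnM ?posrE ?exprn_gt0// !lnXn//.
by ring.
Qed.

Lemma sum_eta_cblock s :
  \sum_c eta (exp_point x y z (clabel (s := s) c)) =
  eta (iR / iL * gamma s) + iR / iL * gamma s * ln (Aenum (ctype M s) z)
  - ln z * \sum_c (hweight c)%:R * exp_point x y z (clabel (s := s) c).
Proof.
have A0 := Aenum_gt0 (ctype M s) z0.
transitivity (\sum_c (exp_point x y z (clabel (s := s) c) *
     (ln (Aenum (ctype M s) z) - ln (iR / iL * gamma s))
   - ln z * ((hweight c)%:R * exp_point x y z (clabel (s := s) c)))); last first.
  by rewrite !sumrB -!mulr_sumr -mulr_suml exp_point_cblock /eta; ring.
apply: eq_bigr => c _.
have [/andP[/= d0 h]|na] := boolP (active (clabel (s := s) c)); last first.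
  by rewrite exp_point_inactive// eta0; ring.
rewrite {1}/eta {2}/exp_point /= h lnM ?posrE// ?divr_gt0 ?exprn_gt0//.
rewrite ln_div ?posrE ?exprn_gt0// !lnXn// -/iR -/iL.
by ring.
Qed.

(** The terms with [ln y] and [ln z] combine through [solution_ln_yz] and cancel against the edge
    terms, up to [iL^-1 * ln (1 - b * iL)]. *)
Lemma growth_formulaE : growth_formula M alpha x y z b =
  growth_exponent (@wt_out _ M) (@density _ M) iL^-1 (exp_point x y z).
Proof.
have /solution_exp_point[b0 h1 h2 h3 h4] := sol.
have eV : \sum_t \sum_m eta (exp_point x y z (vlabel (t := t) m)) =
    \sum_(t < nv M) eta (delta t) + \sum_t delta t * ln (Benum (vtype M t) x y)
    - ln x * alpha - ln y * b.
  rewrite (eq_bigr _ (fun t _ => sum_eta_vblock t)) !sumrB big_split/= -!mulr_sumr.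
  by rewrite -mean_in -mean_out h1 h2.
have eC : \sum_s \sum_c eta (exp_point x y z (clabel (s := s) c)) =
    \sum_(s < nc M) eta (iR / iL * gamma s) + iR / iL * (\sum_s gamma s * ln (Aenum (ctype M s) z))
    - ln z * b.
  rewrite (eq_bigr _ (fun s _ => sum_eta_cblock s)) sumrB big_split/= -mulr_sumr.
  by rewrite -mean_chk h3 mulr_sumr; congr (_ + _ - _); apply: eq_bigr => s _; rewrite mulrA.
have Lb : 0 < iL^-1 - b by rewrite subr_gt0 solution_beta_lt.
have hl : ln (1 - b * iL) = ln (iL^-1 - b) - ln iL^-1.
  by rewrite -ln_div ?posrE ?invr_gt0//; congr ln; field; rewrite gt_eqF.
rewrite /growth_exponent /entropy h2 sum_label eV eC big_sumType/=.
rewrite /growth_formula -/iR -/iL hl.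
have etaE (r : R) : eta r = - (r * ln r) by [].
have := solution_ln_yz; rewrite (etaE b) (etaE (iL^-1 - b)) (etaE iL^-1).
move: (\sum_(t < nv M) delta t * ln (Benum (vtype M t) x y))
  (iR / iL * \sum_(s < nc M) gamma s * ln (Aenum (ctype M s) z))
  (\sum_(t < nv M) eta (delta t)) (\sum_(s < nc M) eta (iR / iL * gamma s)) => S1 S2 S3 S4.
move: (ln x) (ln y) (ln z) (ln b) (ln (iL^-1 - b)) (ln iL^-1) => lx ly lz lb lB lL e.
have -> : ly = lb - lB - lz by rewrite -e; ring.
ring.
Qed.

End Solution.
End ExponentialPoint.

(** * The maximizer *)

Section Maximum.
Context {R : realType} (M : ensemble R) (alpha : R) (alpha_gt0 : 0 < alpha).
Let iL := int_lambda M.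
Let iR := int_rho M.
Let iL0 : 0 < iL. Proof. exact: int_lambda_gt0. Qed.
Let iR0 : 0 < iR. Proof. exact: int_rho_gt0. Qed.

Lemma sum_multipliers (mu : constraint_index M -> R) (i : label M) : active i ->
  \sum_k mu k * (constraint k i)%:~R =
  mu (inl (inl (label_type i))) + mu (inl (inr true)) * (wt_in i)%:R +
  mu (inl (inr false)) * ((wt_out i)%:R - (wt_chk i)%:R).
Proof.
move=> ai; rewrite big_sumType/= [X in _ + X]big1 ?addr0; last first.
  by move=> j _; have [<-|ne] := eqVneq i j; rewrite ?ai mulr0.
rewrite big_sumType/= big_bool/= intrB addrA; congr (_ + _ + _).
rewrite (bigD1 (label_type i))//= eqxx mulr1 big1 ?addr0// => t ne.
by rewrite eq_sym (negbTE ne) mulr0.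
Qed.

(** Exponentiating the Lagrange equations gives Gibbs weights with one factor per node type; the
    block sums identify these factors as densities over partition functions. *)
Lemma stationary_solution (X : label M -> R) (mu : constraint_index M -> R) :
  in_polytope alpha X -> (forall i, active i -> 0 < X i) ->
  mean (@wt_out _ M) X < iL^-1 ->
  (forall i, 0 < X i ->
    ln (X i) + 1 - (wt_out i)%:R * (ln (mean (@wt_out _ M) X) -
      ln (iL^-1 - mean (@wt_out _ M) X)) = \sum_k mu k * (constraint k i)%:~R) ->
  exists x y z, is_positive_solution M alpha x y z (mean (@wt_out _ M) X) /\
    X = exp_point x y z.
Proof.
set b := mean _ X => fX pX bL hmu.
have b0 : 0 < b by exact: (polytope_out_gt0 alpha_gt0 fX).
have Lb : 0 < iL^-1 - b by rewrite subr_gt0.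
set ell := ln b - ln (iL^-1 - b) in hmu.
pose g := mu (inl (inr false)).
(* The multiplier [g] of the balance constraint enters variable and check labels with opposite
   signs, so it cancels in [y * z = expR ell], which is the fourth equation. *)
pose x := expR (mu (inl (inr true))); pose y := expR (ell + g); pose z := expR (- g).
pose c t := expR (mu (inl (inl t)) - 1).
have x0 : 0 < x by exact: expR_gt0.
have y0 : 0 < y by exact: expR_gt0.
have z0 : 0 < z by exact: expR_gt0.
have XE i : active i -> X i =
    c (label_type i) * (x ^+ wt_in i * y ^+ wt_out i * z ^+ wt_chk i).
  move=> ai; rewrite -[X i]lnK ?posrE ?pX//.
  rewrite /c /x /y /z -!expRM_natl -!expRD; congr expR.
  have := hmu i (pX i ai); rewrite sum_multipliers// -/g => e.
  have -> : ln (X i) = mu (inl (inl (label_type i))) + mu (inl (inr true)) * (wt_in i)%:R +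
      g * ((wt_out i)%:R - (wt_chk i)%:R) - 1 + (wt_out i)%:R * ell by rewrite -e; ring.
  by ring.
have cv t : 0 < delta t -> c (inl t) = delta t / Benum (vtype M t) x y.
  move=> d0; have B0 := Benum_gt0 (vtype M t) x0 y0.
  rewrite -(polytope_vblock fX t) BenumE.
  rewrite (eq_bigr (fun m => c (inl t) * (x ^+ hweight m * y ^+ hweight (m *m vgen (vtype M t))))).
    by rewrite -mulr_sumr -BenumE mulfK// gt_eqF.
  move=> m _; rewrite XE ?mulr1// /active andbT; exact: d0.
have cc s : 0 < density (inr s : node_type M) ->
    c (inr s) = iR / iL * gamma s / Aenum (ctype M s) z.
  move=> d0; have A0 := Aenum_gt0 (ctype M s) z0.
  rewrite -(polytope_cblock fX s) (bigID (fun w => w \in ccode (ctype M s)))/=.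
  rewrite [X in _ + X]big1 ?addr0; last first.
    by move=> w nw; apply: (polytope_inactive fX); rewrite /active negb_and /= nw orbT.
  rewrite (eq_bigr (fun w => c (inr s) * z ^+ hweight w)).
    by rewrite -mulr_sumr -AenumE mulfK// gt_eqF.
  by move=> w hw; rewrite XE ?expr0 ?mul1r// /active/= hw andbT.
have XEq : X = exp_point x y z.
  apply/funext => i; have [ai|na] := boolP (active i); last first.
    by rewrite (polytope_inactive fX na) exp_point_inactive.
  rewrite XE//; move: (ai) => /andP[d0 hc]; rewrite /exp_point.
  case: i d0 hc {ai} => [[t m]|[s w]] /= d0 hc.
    by rewrite cv// mulr1 mulrAC mulrA.
  by rewrite cc// hc !mul1r mulrAC mulrA.
exists x, y, z; split=> //; apply/solution_exp_point => //; rewrite -XEq; split=> //.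
- exact: (polytope_in fX).
- exact: (polytope_chk fX).
rewrite -expRD (_ : ell + g - g = ell); last by ring.
rewrite /ell -ln_div ?posrE// lnK ?posrE ?divr_gt0// -/iL.
have -> : 1 + b / (iL^-1 - b) = iL^-1 / (iL^-1 - b).
  by rewrite -{1}(divff (lt0r_neq0 Lb)) -mulrDl subrK.
by rewrite mulrA mulfK// gt_eqF.
Qed.

Context (x0 y0 z0 beta : R).
Hypothesis sol : is_positive_solution M alpha x0 y0 z0 beta.
Hypothesis uniq : forall x y z b : R, is_positive_solution M alpha x y z b ->
       [/\ x = x0, y = y0, z = z0 & b = beta].
Hypothesis all_one : all_one_codeword M alpha ->
       0 <= growth_formula M alpha x0 y0 z0 beta.

Let X0 := @exp_point R M x0 y0 z0.
Let Phi := growth_exponent (@wt_out _ M) (@density _ M) iL^-1.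

Lemma solution_point_in_polytope : in_polytope alpha X0.
Proof. by case: sol => -[x00 y00 z00 _] _; exact: (exp_point_in_polytope _ _ _ sol). Qed.

Lemma solution_point_gt0 i : active i -> 0 < X0 i.
Proof. by case: sol => -[x00 y00 z00 _] _; exact: exp_point_gt0. Qed.

Lemma growth_formula_point : growth_formula M alpha x0 y0 z0 beta = Phi X0.
Proof. by case: sol => -[x00 y00 z00 _] _; exact: growth_formulaE. Qed.

(** The last family of constraints kills inactive coordinates, and [X0] is positive on the active
    ones. *)
Lemma kernel_inactive (d : label M -> R) :
  (forall k, \sum_i (constraint k i)%:~R * d i = 0) -> forall i, X0 i = 0 -> d i = 0.
Proof.
move=> hd i i0; have [|_ _ _] := (@constraintP _ M (fun=> 0) 0 d).1.
  by case=> [[t|[]]|j]; rewrite hd.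
apply; apply/negP => /solution_point_gt0; by rewrite i0 ltxx.
Qed.

(** On the boundary the exponent is 0 and [all_one] applies; a critical point inside comes from a
    solution, which by [uniq] is the given one. *)
Theorem polytope_max (X : label M -> R) : in_polytope alpha X ->
  Phi X <= growth_formula M alpha x0 y0 z0 beta.
Proof.
move=> fX; rewrite growth_formula_point /Phi /growth_exponent lerD2r lerD2r.
apply: (@entropy_max _ _ _ (@constraint _ M) _ _
  (rhs (@density _ M) alpha) X0 (\sum_t density t)) => //.
- exact: solution_point_in_polytope.
- by move=> Y fY i; exact: (polytope_le fY).
- exact: kernel_inactive.
- by move=> Y fY; rewrite (polytope_out_gt0 alpha_gt0 fY) (polytope_out_le fY).
- move=> Y fY hb; have [ao e] := polytope_boundary fY hb.
  have := all_one ao; rewrite growth_formula_point -e /Phi /growth_exponent.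
  by rewrite lerD2r lerD2r.
- move=> Y mu fY zY pY hb hmu.
  have pY' i : active i -> 0 < Y i by move=> /solution_point_gt0; exact: pY.
  have [x [y [z [s ->]]]] := stationary_solution fY pY' hb hmu.
  by have [-> -> -> _] := uniq s.
Qed.

End Maximum.

(** * The growth rate *)

Lemma sum_tagged (I : finType) (J : I -> finType) (f : I -> nat) :
  (\sum_(x : {i : I & J i}) f (tag x) = \sum_i #|J i| * f i)%N.
Proof.
transitivity (\sum_i \sum_(j : J i) f i)%N.
  by rewrite sig_big_dep; apply: eq_bigl => -[].
by apply: eq_bigr => i _; rewrite sum_nat_const.
Qed.

Section FixedLength.
Context {R : realType} (M : ensemble R) (alpha : R) (alpha_gt0 : 0 < alpha).
Let iL := int_lambda M.
Let iR := int_rho M.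
Let iL0 : 0 < iL. Proof. exact: int_lambda_gt0. Qed.
Let iR0 : 0 < iR. Proof. exact: int_rho_gt0. Qed.
Let Phi := growth_exponent (@wt_out _ M) (@density _ M) iL^-1.

Context (n : nat) (n_gt0 : (0 < n)%N) (adm : admissible M n)
  (alphan : alpha * n%:R \is a Num.int).

Let nR : 0 < n%:R :> R. Proof. by rewrite ltr0n. Qed.
Let k := Num.truncn (alpha * n%:R).
Let E := #|vsocket M n|.

Lemma truncn_alpha : k%:R = n%:R * alpha :> R.
Proof. by rewrite truncnK ?natrEint ?alphan ?mulr_ge0 ?ltW// mulrC. Qed.

Lemma nvarsE (t : 'I_(nv M)) : (nvars n t)%:R = n%:R * delta t :> R.
Proof.
rewrite truncnK ?adm.2// /edges /delta -/iL; field.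
by rewrite gt_eqF//= gt_eqF// ltr0n vlen_gt0.
Qed.

Lemma nchecksE (s : 'I_(nc M)) : (nchecks n s)%:R = n%:R * (iR / iL * gamma s) :> R.
Proof.
rewrite truncnK ?adm.1// /edges /gamma -/iL -/iR; field.
by rewrite !gt_eqF// ltr0n clen_gt0.
Qed.

Lemma card_ntype (t : node_type M) : #|fiber (@ntype _ M n) t|%:R = n%:R * density t :> R.
Proof.
have -> : #|fiber (@ntype _ M n) t| =
    (\sum_(v : vnode M n) (inl (tag v) == t) + \sum_(c : cnode M n) (inr (tag c) == t))%N.
  by rewrite -sum1_card big_mkcond big_sumType/=; congr addn; apply: eq_bigr => a _;
    rewrite inE; case: eqP.
rewrite (sum_tagged _ (fun t' : 'I_(nv M) => nat_of_bool (inl t' == t)))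
  (sum_tagged _ (fun s' : 'I_(nc M) => nat_of_bool (inr s' == t))).
case: t => t /=.
  rewrite [X in (_ + X)%N]big1 ?addn0; last by move=> s _; rewrite muln0.
  rewrite (bigD1 t)//= eqxx muln1 card_ord big1 ?addn0 ?nvarsE// => t' ne.
  by rewrite -[inl t' == inl t]/(t' == t) (negbTE ne) muln0.
rewrite [X in (X + _)%N]big1 ?add0n; last by move=> s _; rewrite muln0.
rewrite (bigD1 t)//= eqxx muln1 card_ord big1 ?addn0 ?nchecksE// => t' ne.
by rewrite -[inr t' == inr t]/(t' == t) (negbTE ne) muln0.
Qed.

Lemma card_vsocket : E%:R = n%:R * iL^-1 :> R.
Proof.
rewrite /E -sum1_card (sum_tagged (fun v : vnode M n => 'I_(vlen (vtype M (tag v)))) (fun=> 1%N)).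
under eq_bigr do rewrite card_ord muln1.
rewrite (sum_tagged (fun t => 'I_(nvars n t)) (fun t => vlen (vtype M t))).
rewrite natr_sum -sum_vlen_density mulr_sumr; apply: eq_bigr => t _.
by rewrite card_ord natrM nvarsE -mulrA; congr (_ * _); exact: mulrC.
Qed.

Lemma card_csocket : #|csocket M n|%:R = n%:R * iL^-1 :> R.
Proof.
rewrite -sum1_card (sum_tagged (fun v : cnode M n => 'I_(clen (ctype M (tag v)))) (fun=> 1%N)).
under eq_bigr do rewrite card_ord muln1.
rewrite (sum_tagged (fun t => 'I_(nchecks n t)) (fun t => clen (ctype M t))).
rewrite natr_sum -sum_clen_density mulr_sumr; apply: eq_bigr => t _.
by rewrite card_ord natrM nchecksE -mulrA; congr (_ * _); exact: mulrC.
Qed.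

Lemma sockets_eq : #|vsocket M n| = #|csocket M n|.
Proof. by apply/eqP; rewrite -(eqr_nat R) card_vsocket card_csocket. Qed.

Definition admissible_type (N : {ffun label M -> nat}) : bool :=
  [&& [forall i, codeword_label i || (N i == 0%N)],
      (\sum_i wt_in i * N i)%N == k &
      (\sum_i wt_out i * N i)%N == (\sum_i wt_chk i * N i)%N].

(** For [j] ones with [j <= E] this is [1 / 'C(E, j)], the chance that a random permutation matches
    two patterns with [j] ones. *)
Definition type_prob (N : {ffun label M -> nat}) : R :=
  (\sum_i wt_out i * N i)%N`!%:R * (E - \sum_i wt_out i * N i)%N`!%:R / E`!%:R.

Lemma expected_num_types : expected_num M n k =
  \sum_(F : {ffun node M n -> label M} |
     compat (@ntype _ M n) (@label_type _ M) F && admissible_type (type_of F))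
    type_prob (type_of F).
Proof.
rewrite (expected_numE sockets_eq); apply: eq_big => [F|F _]; last first.
  by rewrite /type_prob -sum_type_of.
rewrite /compat; congr (_ && _); rewrite /admissible_type -!sum_type_of; congr (_ && _).
apply/forallP/forallP => [h i|h a].
  have [//|ni] := boolP (codeword_label i); rewrite ffunE.
  by apply/eqP/eq_card0 => a; rewrite inE; apply: contraNF ni => /eqP <-.
have /orP[//|] := h (F a); rewrite ffunE => /eqP/card0_eq/(_ a).
by rewrite inE eqxx.
Qed.

Lemma rhs_scale (K : constraint_index M) :
  rhs (fun t => n%:R * density t) (n%:R * alpha) K = n%:R * rhs (@density _ M) alpha K.
Proof. by case: K => [[t|[]]|j] //=; rewrite mulr0. Qed.

(** Translates the combinatorial conditions on a type into the linear constraints at scale [n]. An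
    inactive label has count 0 because its type has no nodes or its word is not a codeword. *)
Lemma admissible_typeP (N : {ffun label M -> nat}) :
  (admissible_type N /\
   forall t, (\sum_(i | label_type i == t) N i = #|fiber (@ntype _ M n) t|)%N) <->
  forall K, \sum_i (constraint K i)%:~R * (N i)%:R = n%:R * rhs (@density _ M) alpha K.
Proof.
have meanE w : mean w (fun i : label M => (N i)%:R) = (\sum_i w i * N i)%N%:R :> R.
  by rewrite natr_sum; apply: eq_bigr => i _; rewrite natrM.
have -> : (forall K, \sum_i (constraint K i)%:~R * (N i)%:R =
    n%:R * rhs (@density _ M) alpha K) <-> (forall K, \sum_i (constraint K i)%:~R * (N i)%:R =
    rhs (fun t => n%:R * density t) (n%:R * alpha) K).
  by split=> h K; have := h K; rewrite rhs_scale.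
rewrite constraintP !meanE -truncn_alpha.
split=> [[/and3P[/forallP cN /eqP -> /eqP ->] hb]|[hb h1 h2 h3]].
  split=> [t|||i]//; first by rewrite -natr_sum hb card_ntype.
  rewrite /active negb_and => /orP[d0|ni]; last first.
    by have := cN i; rewrite (negbTE ni) => /eqP ->.
  have e0 : density (label_type i) = 0.
    by apply/eqP; rewrite eq_le density_ge0 andbT leNgt.
  have := card_ntype (label_type i); rewrite e0 mulr0 -hb => /eqP.
  rewrite pnatr_eq0 sum_nat_eq0 => /forallP/(_ i); rewrite eqxx => /eqP ->.
  by [].
split; last first.
  by move=> t; apply/eqP; rewrite -(eqr_nat R) natr_sum hb card_ntype.
apply/and3P; split; rewrite -?(eqr_nat R) ?h1 ?h2//.
apply/forallP => i; have [//|ni] := boolP (codeword_label i).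
have := h3 i; rewrite /active negb_and ni orbT => /(_ isT)/eqP.
by rewrite pnatr_eq0.
Qed.

Lemma scaled_in_polytope (N : {ffun label M -> nat}) :
  (forall K, \sum_i (constraint K i)%:~R * (N i)%:R = n%:R * rhs (@density _ M) alpha K) ->
  in_polytope alpha (fun i => (N i)%:R / n%:R).
Proof.
move=> h; split=> [i|K]; first by rewrite divr_ge0.
under eq_bigr do rewrite mulrA.
by rewrite -mulr_suml h mulrC mulKf// gt_eqF.
Qed.

(** [kappa * n] bounds the numbers of nodes and of edges, hence all counts in the Stirling
    estimate. *)
Let kappa : R := \sum_t @density _ M t + iL^-1.
Let c : R := #|node_type M|%:R + #|label M|%:R + 3.

(** The Stirling estimate holds for the integral counts; homogeneity then extracts the factor
    [n]. *)
Lemma class_term_bound (N : {ffun label M -> nat}) :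
  (forall K, \sum_i (constraint K i)%:~R * (N i)%:R = n%:R * rhs (@density _ M) alpha K) ->
  `| ln (class_size (@ntype _ M n) N * type_prob N) - n%:R * Phi (fun i => (N i)%:R / n%:R) |
     <= c * (1 + ln (kappa * n%:R + 1)).
Proof.
move=> hN; have [aN bN] := (admissible_typeP N).2 hN.
have fN := scaled_in_polytope hN.
have sD : \sum_i N i = (\sum_t #|fiber (@ntype _ M n) t|)%N.
  rewrite (partition_big (@label_type _ M) xpredT)//=; apply: eq_bigr => t _.
  by rewrite -bN; apply: eq_bigl.
have D0 : 0 <= \sum_t @density _ M t by apply: sumr_ge0 => t _; exact: density_ge0.
have hm t : #|fiber (@ntype _ M n) t|%:R <= kappa * n%:R :> R.
  rewrite card_ntype mulrC ler_wpM2r// /kappa (bigD1 t)//= -addrA lerDl.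
  by rewrite addr_ge0 ?invr_ge0 ?(ltW iL0)// sumr_ge0// => t' _; exact: density_ge0.
have hNi i : (N i)%:R <= kappa * n%:R :> R.
  apply: le_trans (hm (label_type i)); rewrite ler_nat -bN (bigD1 i)//=.
  exact: leq_addr.
have hE : E%:R <= kappa * n%:R :> R.
  by rewrite card_vsocket mulrC ler_wpM2r// /kappa lerDr.
have jE : (\sum_i wt_out i * N i <= E)%N.
  rewrite -(ler_nat R) card_vsocket.
  have -> : (\sum_i wt_out i * N i)%N%:R =
      n%:R * mean (@wt_out _ M) (fun i => (N i)%:R / n%:R) :> R.
    rewrite /mean mulr_sumr natr_sum; apply: eq_bigr => i _.
    by rewrite natrM mulrCA [n%:R * _]mulrC divfK// gt_eqF.
  by rewrite ler_pM2l// (polytope_out_le fN).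
have := ln_class_term jE sD erefl hm hNi hE.
rewrite -/c /class_size /type_prob.
have := @growth_exponent_scale R _ _ (@wt_out _ M) n%:R (@density _ M) iL^-1
  (fun i => (N i)%:R / n%:R) nR (@density_ge0 _ M) fN.1.
rewrite (polytope_out_le fN) (ltW (polytope_out_gt0 alpha_gt0 fN)) => /(_ isT).
have -> : (fun i => n%:R * ((N i)%:R / n%:R)) = (fun i => (N i)%:R) :> (label M -> R).
  by apply/funext => i; rewrite mulrC divfK// gt_eqF.
have -> : (fun t => n%:R * density t) =
    (fun t => #|fiber (@ntype _ M n) t|%:R) :> (node_type M -> R).
  by apply/funext => t; rewrite card_ntype.
rewrite -card_vsocket => ->//.
rewrite -mulr_suml -natr_sum sD natr_sum; under eq_bigr do rewrite card_ntype.
by rewrite -mulr_sumr mulrC mulKf// gt_eqF.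
Qed.

Lemma class_term_gt0 (N : {ffun label M -> nat}) :
  0 < class_size (@ntype _ M n) N * type_prob N :> R.
Proof.
rewrite mulr_gt0// divr_gt0 ?mulr_gt0 ?natr_fact_gt0//;
  apply: prodr_gt0 => i _; exact: natr_fact_gt0.
Qed.

Lemma type_prob_ge0 N : 0 <= type_prob N.
Proof. by rewrite divr_ge0 ?mulr_ge0. Qed.

Lemma card_node_le : #|node M n|%:R <= kappa * n%:R :> R.
Proof.
rewrite (card_fiber_sum (@ntype _ M n)) natr_sum.
under eq_bigr do rewrite card_ntype.
by rewrite -mulr_sumr mulrC ler_wpM2r// /kappa lerDl invr_ge0 ltW.
Qed.

Lemma expected_num_upper (g : R) :
  (forall X, in_polytope alpha X -> Phi X <= g) -> 0 < expected_num M n k ->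
  ln (expected_num M n k) <=
    n%:R * g + (c + #|label M|%:R) * (1 + ln (kappa * n%:R + 1)).
Proof.
(* [B] bounds the contribution of a single type. The number of types is polynomial in [n] and adds
   the [#|label M|] to the constant. *)
move=> hg e0; pose B := expR (n%:R * g + c * (1 + ln (kappa * n%:R + 1))).
have k0 : 0 < kappa * n%:R + 1 by rewrite ltr_wpDl// (le_trans _ card_node_le).
have hB : expected_num M n k <= (#|node M n|.+1 ^ #|label M|)%:R * B.
  rewrite expected_num_types; apply: sum_types_le; first exact: expR_ge0.
  move=> N aN bN; have hN := (admissible_typeP N).1 (conj aN bN).
  rewrite -ler_ln ?posrE ?expR_gt0 ?class_term_gt0// expRK.
  have h : n%:R * Phi (fun i => (N i)%:R / n%:R) <= n%:R * g.
    by rewrite ler_pM2l// hg//; exact: scaled_in_polytope hN.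
  by have := class_term_bound hN; rewrite ler_distl => /andP[_]; lra.
have l1 : ln #|node M n|.+1%:R <= 1 + ln (kappa * n%:R + 1).
  apply: (@le_trans _ _ (ln (kappa * n%:R + 1))); last by rewrite lerDr.
  by rewrite ler_ln ?posrE ?ltr0n// -natr1 lerD2r card_node_le.
have P0 : 0 < (#|node M n|.+1 ^ #|label M|)%:R :> R by rewrite ltr0n expn_gt0.
have B0 : 0 < B by exact: expR_gt0.
apply: le_trans (_ : ln ((#|node M n|.+1 ^ #|label M|)%:R * B) <= _).
  by rewrite ler_ln ?posrE ?(mulr_gt0 P0 B0).
rewrite lnM ?posrE// expRK natrX lnXn ?ltr0n//.
rewrite -[ln _ *+ _]mulr_natl.
by rewrite [leLHS]addrC (mulrDl c) [leRHS]addrA lerD2l ler_wpM2l.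
Qed.

(** Supplies the integral solution from which one near the maximizer is reached: a positive
    expectation has at least one term. *)
Lemma exists_type : 0 < expected_num M n k -> exists N : {ffun label M -> nat},
  forall K, \sum_i (constraint K i)%:~R * (N i)%:R = n%:R * rhs (@density _ M) alpha K.
Proof.
rewrite expected_num_types => e0.
have [[F /andP[cF aF]]|no] := pselect (exists F : {ffun node M n -> label M},
    compat (@ntype _ M n) (@label_type _ M) F && admissible_type (type_of F)).
  by exists (type_of F); apply/admissible_typeP; split=> //; exact: type_of_compat.
by move: e0; rewrite big1 ?ltxx// => F hF; case: no; exists F.
Qed.

Lemma expected_num_lower (N : {ffun label M -> nat}) :
  (forall K, \sum_i (constraint K i)%:~R * (N i)%:R = n%:R * rhs (@density _ M) alpha K) ->
  n%:R * Phi (fun i => (N i)%:R / n%:R) - c * (1 + ln (kappa * n%:R + 1)) <=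
    ln (expected_num M n k).
Proof.
move=> hN; have [aN bN] := (admissible_typeP N).2 hN.
have h : class_size (@ntype _ M n) N * type_prob N <= expected_num M n k.
  by rewrite expected_num_types; apply: sum_types_ge => // ?; exact: type_prob_ge0.
have e0 : 0 < expected_num M n k by apply: lt_le_trans h; exact: class_term_gt0.
apply: le_trans (_ : ln (class_size (@ntype _ M n) N * type_prob N) <= _); last first.
  by rewrite ler_ln ?posrE ?class_term_gt0.
by have := class_term_bound hN; rewrite ler_distl => /andP[].
Qed.

End FixedLength.

Theorem theorem1 (R : realType) (M : ensemble R) (alpha : R)
    (alpha_gt0 : 0 < alpha)
    (index_infinite : infinite_set (growth_index M alpha))
    (x0 y0 z0 beta : R)
    (solution : is_positive_solution M alpha x0 y0 z0 beta)
    (solution_unique : forall x y z b : R,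
       is_positive_solution M alpha x y z b ->
       [/\ x = x0, y = y0, z = z0 & b = beta])
    (all_one_ge0 : all_one_codeword M alpha ->
       0 <= growth_formula M alpha x0 y0 z0 beta) :
  growth_seq M alpha n @[n --> within (growth_index M alpha) \oo]
    --> growth_formula M alpha x0 y0 z0 beta.
Proof.
have gE := growth_formula_point solution.
have fX0 := solution_point_in_polytope solution.
have hmax := polytope_max alpha_gt0 solution solution_unique all_one_ge0.
have [B [n0 hB]] := near_integer_point fX0 (kernel_inactive solution).
rewrite /growth_seq gE.
pose kappa : R := \sum_t @density _ M t + (int_lambda M)^-1.
have kappa0 : 0 <= kappa.
  by rewrite addr_ge0 ?invr_ge0 ?(ltW (int_lambda_gt0 M))// sumr_ge0// => t _; exact: density_ge0.
apply: (growth_limit (c1 := #|node_type M|%:R + #|label M|%:R + 3 + #|label M|%:R)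
  (c2 := #|node_type M|%:R + #|label M|%:R + 3) (B := B) (n0 := n0) kappa0).
  move=> n [n_gt0 adm ani e0] _; rewrite -gE.
  exact: (expected_num_upper alpha_gt0 n_gt0 adm ani hmax e0).
move=> n [n_gt0 adm ani e0] nn0 _.
(* [N1] may be far from the maximizer; [hB] replaces it by a type within bounded distance of [n]
   times the maximizer. *)
have [N1 hN1] := exists_type alpha_gt0 n_gt0 adm ani e0.
have [N hN hd] := hB n N1 nn0 n_gt0 hN1.
exists (fun i => (N i)%:R / n%:R) => //.
have := @expected_num_lower _ _ _ alpha_gt0 _ n_gt0 adm ani (finfun N).
have -> : (fun i => (finfun N i)%:R / n%:R) = (fun i => (N i)%:R / n%:R) :> (label M -> R).
  by apply/funext => i; rewrite ffunE.
by apply=> K; rewrite -hN; apply: eq_bigr => i _; rewrite ffunE.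
Qed.
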